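(* Let $(\Theta,\bar\Theta)$ be a twist for a weak Hopf algebra $H$. Then $v=m(S\otimes \mathrm{id})\Theta$ is invertible in $H$, and there is a weak Hopf algebra $H_\Theta$ having the same algebra structure and the same counit as $H$, with comultiplication and antipode given by $$\Delta_\Theta(h)=\bar\Theta\,\Delta(h)\,\Theta,\qquad S_\Theta(h)=v^{-1}S(h)v,\qquad h\in H_\Theta .$$
   Context: $k$ is an algebraically closed field; Sweedler notation $\Delta(h)=h_{(1)}\otimes h_{(2)}$ is used. A weak bialgebra is a $k$-vector space $H$ with an algebra structure $(m,1)$ and a coalgebra structure $(\Delta,\varepsilon)$ such that for all $h,g,f\in H$: $\Delta(hg)=\Delta(h)\Delta(g)$; $\varepsilon(hgf)=\varepsilon(hg_{(1)})\varepsilon(g_{(2)}f)=\varepsilon(hg_{(2)})\varepsilon(g_{(1)}f)$; $(\Delta\otimes\mathrm{id})\Delta(1)=(\Delta(1)\otimes1)(1\otimes\Delta(1))=(1\otimes\Delta(1))(\Delta(1)\otimes1)$. A weak Hopf algebra is a weak bialgebra with a linear map $S:H\to H$ (antipode) such that $m(\mathrm{id}\otimes S)\Delta(h)=(\varepsilon\otimes\mathrm{id})(\Delta(1)(h\otimes1))$, $m(S\otimes\mathrm{id})\Delta(h)=(\mathrm{id}\otimes\varepsilon)((1\otimes h)\Delta(1))$, and $S(h_{(1)})h_{(2)}S(h_{(3)})=S(h)$ for all $h\in H$. A twist for a weak Hopf algebra $H$ is a pair $(\Theta,\bar\Theta)$ with $\Theta\in\Delta(1)(H\otimes H)$, $\bar\Theta\in(H\otimes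 H)\Delta(1)$, $\Theta\bar\Theta=\Delta(1)$, satisfying $(\varepsilon\otimes\mathrm{id})\Theta=(\mathrm{id}\otimes\varepsilon)\Theta=(\varepsilon\otimes\mathrm{id})\bar\Theta=(\mathrm{id}\otimes\varepsilon)\bar\Theta=1$, $(\Delta\otimes\mathrm{id})(\Theta)(\Theta\otimes1)=(\mathrm{id}\otimes\Delta)(\Theta)(1\otimes\Theta)$, $(\bar\Theta\otimes1)(\Delta\otimes\mathrm{id})(\bar\Theta)=(1\otimes\bar\Theta)(\mathrm{id}\otimes\Delta)(\bar\Theta)$, $(\Delta\otimes\mathrm{id})(\bar\Theta)(\mathrm{id}\otimes\Delta)(\Theta)=(\Theta\otimes1)(1\otimes\bar\Theta)$, $(\mathrm{id}\otimes\Delta)(\bar\Theta)(\Delta\otimes\mathrm{id})(\Theta)=(1\otimes\Theta)(\bar\Theta\otimes1)$. *)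

(* Defs.v *)
From HB Require Import structures.
From mathcomp Require Import all_boot all_algebra boolp.

Set Implicit Arguments.
Unset Strict Implicit.
Unset Printing Implicit Defensive.
Import GRing.Theory.
Local Open Scope ring_scope.
Local Open Scope quotient_scope.

Reserved Notation "V ⊗ W" (at level 40, left associativity).

(** * Algebras
    [algType] requires [1 != 0]; here the zero algebra is allowed. The product
    and unit are those of the canonical [pzRingType] structure on a
    [pzAlgType], so that [x * y] and [1] have their usual meaning. *)

HB.mixin Record Lmodule_isPzAlgebra (k : fieldType) H
    of GRing.Lmodule k H := {
  pz_one : H;
  pz_mul : H -> H -> H;
  pz_mulA : associative pz_mul;
  pz_mul1l : left_id pz_one pz_mul;
  pz_mul1r : right_id pz_one pz_mul;
  pz_mulDl : left_distributive pz_mul +%R;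
  pz_mulDr : right_distributive pz_mul +%R;
  pz_scaleAl : forall (c : k) (x y : H),
    c *: pz_mul x y = pz_mul (c *: x) y;
  pz_scaleAr : forall (c : k) (x y : H),
    c *: pz_mul x y = pz_mul x (c *: y)
}.

#[short(type="pzAlgType")]
HB.structure Definition PzAlgebra (k : fieldType) :=
  {H of GRing.Lmodule k H & Lmodule_isPzAlgebra k H}.

HB.instance Definition _ (k : fieldType) (H : pzAlgType k) :=
  GRing.Zmodule_isPzRing.Build (PzAlgebra.sort H)
    pz_mulA pz_mul1l pz_mul1r pz_mulDl pz_mulDr.

Lemma pzscalerAl (k : fieldType) (H : pzAlgType k) (c : k) (x y : H) :
  c *: (x * y) = (c *: x) * y.
Proof. exact: pz_scaleAl. Qed.

Lemma pzscalerAr (k : fieldType) (H : pzAlgType k) (c : k) (x y : H) :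
  c *: (x * y) = x * (c *: y).
Proof. exact: pz_scaleAr. Qed.

(** * Tensor product of two vector spaces of arbitrary dimension
    The sequence [:: (v_1, w_1); ...; (v_n, w_n)] stands for
    v_1 ⊗ w_1 + ... + v_n ⊗ w_n; two sequences denote the same tensor when every
    bilinear map takes the same value on both. *)

Section Tensor.
Variables (k : fieldType) (V W : lmodType k).
Implicit Types s : seq (V * W).

Definition formal_eval (U : zmodType) (f : V -> W -> U) s : U :=
  \sum_(p <- s) f p.1 p.2.

Definition tensor_eqv s1 s2 : bool :=
  `[< forall (U : lmodType k) (f : V -> W -> U), bilinear_for *:%R *:%R f ->
        formal_eval f s1 = formal_eval f s2 >].

Lemma tensor_eqv_equiv : equiv_class_of tensor_eqv.
Proof.
split=> [s|s1 s2|s2 s1 s3].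
- exact/asboolP.
- by apply/idP/idP => /asboolP E; apply/asboolP => U f bf; rewrite E.
- move=> /asboolP E1 /asboolP E2; apply/asboolP => U f bf.
  by rewrite E1 ?E2.
Qed.

Canonical tensor_eqv_equiv_rel := EquivRelPack tensor_eqv_equiv.

Definition tensor := {eq_quot tensor_eqv}.

HB.instance Definition _ := Choice.on tensor.
HB.instance Definition _ := EqQuotient.on tensor.

Definition tens (v : V) (w : W) : tensor := \pi_tensor [:: (v, w)].

(** For bilinear [f], [tlift f] is the linear map sending [v ⊗ w] to [f v w];
    in Sweedler notation, [tlift f t] is [f t_(1) t_(2)]. It is only meaningful
    for bilinear [f]. *)
Definition tlift (U : zmodType) (f : V -> W -> U) (t : tensor) : U :=
  formal_eval f (repr t).

Lemma tlift_pi (U : lmodType k) (f : V -> W -> U) s :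
  bilinear_for *:%R *:%R f -> tlift f (\pi_tensor s) = formal_eval f s.
Proof.
move=> bf; have /eqmodP/asboolP : repr (\pi_tensor s) = s %[mod tensor].
  by rewrite reprK.
exact.
Qed.

Lemma pi_eqP s1 s2 :
  (forall (U : lmodType k) (f : V -> W -> U), bilinear_for *:%R *:%R f ->
     formal_eval f s1 = formal_eval f s2) ->
  \pi_tensor s1 = \pi_tensor s2.
Proof. by move=> E; apply/eqmodP/asboolP. Qed.

Let scale_seq (c : k) s := [seq (c *: p.1, p.2) | p <- s].

Let eval_cat (U : zmodType) (f : V -> W -> U) s1 s2 :
  formal_eval f (s1 ++ s2) = formal_eval f s1 + formal_eval f s2.
Proof. exact: big_cat. Qed.

Let bilinZl (U : lmodType k) (f : V -> W -> U) :
  bilinear_for *:%R *:%R f -> forall c v w, f (c *: v) w = c *: f v w.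
Proof.
move=> [bl _] c v w; have f0 : f 0 w = 0.
  by apply: (addIr (f 0 w)); rewrite add0r -{1}[f 0 w]scale1r -bl scale1r addr0.
by rewrite -[c *: v]addr0 bl f0 addr0.
Qed.

Let eval_scale (U : lmodType k) (f : V -> W -> U) c s :
  bilinear_for *:%R *:%R f ->
  formal_eval f (scale_seq c s) = c *: formal_eval f s.
Proof.
move=> bf; rewrite /formal_eval big_map scaler_sumr.
by apply: eq_bigr => p _; rewrite bilinZl.
Qed.

Definition tadd (x y : tensor) : tensor := \pi_tensor (repr x ++ repr y).
Definition tscale (c : k) (x : tensor) : tensor :=
  \pi_tensor (scale_seq c (repr x)).
Definition tzero : tensor := \pi_tensor [::].

Let liftD (U : lmodType k) (f : V -> W -> U) x y :
  bilinear_for *:%R *:%R f -> tlift f (tadd x y) = tlift f x + tlift f y.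
Proof. by move=> bf; rewrite /tadd tlift_pi// eval_cat. Qed.

Let liftZ (U : lmodType k) (f : V -> W -> U) c x :
  bilinear_for *:%R *:%R f -> tlift f (tscale c x) = c *: tlift f x.
Proof. by move=> bf; rewrite /tscale tlift_pi// eval_scale. Qed.

Let lift0 (U : lmodType k) (f : V -> W -> U) :
  bilinear_for *:%R *:%R f -> tlift f tzero = 0.
Proof. by move=> bf; rewrite /tzero tlift_pi// /formal_eval big_nil. Qed.

Lemma tlift_inj (x y : tensor) :
  (forall (U : lmodType k) (f : V -> W -> U), bilinear_for *:%R *:%R f ->
     tlift f x = tlift f y) -> x = y.
Proof. by move=> E; rewrite -[x]reprK -[y]reprK; apply: pi_eqP. Qed.

Let taddA : associative tadd.
Proof. by move=> x y z; apply: tlift_inj => U f bf; rewrite !liftD// addrA. Qed.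
Let taddC : commutative tadd.
Proof. by move=> x y; apply: tlift_inj => U f bf; rewrite !liftD// addrC. Qed.
Let tadd0 : left_id tzero tadd.
Proof. by move=> x; apply: tlift_inj => U f bf; rewrite liftD// lift0// add0r. Qed.
Let taddN : left_inverse tzero (tscale (-1)) tadd.
Proof.
move=> x; apply: tlift_inj => U f bf.
by rewrite liftD// lift0// liftZ// scaleN1r addNr.
Qed.

HB.instance Definition _ :=
  GRing.isZmodule.Build tensor taddA taddC tadd0 taddN.

Let tscaleA c d (x : tensor) : tscale c (tscale d x) = tscale (c * d) x.
Proof. by apply: tlift_inj => U f bf; rewrite !liftZ// scalerA. Qed.
Let tscale1 : left_id 1 tscale.
Proof. by move=> x; apply: tlift_inj => U f bf; rewrite liftZ// scale1r. Qed.
Let taddE x y : x + y = tadd x y. Proof. by []. Qed.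
Let tscaleDr : right_distributive tscale +%R.
Proof.
move=> c x y; apply: tlift_inj => U f bf.
by rewrite !taddE liftZ// !liftD// !liftZ// scalerDr.
Qed.
Let tscaleDl x : {morph tscale^~ x : c d / c + d}.
Proof.
move=> c d; apply: tlift_inj => U f bf.
by rewrite taddE liftD// !liftZ// scalerDl.
Qed.

HB.instance Definition _ :=
  GRing.Zmodule_isLmodule.Build k tensor tscaleA tscale1 tscaleDr tscaleDl.

Lemma tlift_linear (U : lmodType k) (f : V -> W -> U) :
  bilinear_for *:%R *:%R f -> linear (tlift f).
Proof. by move=> bf c x y; rewrite liftD// liftZ. Qed.

Lemma tlift_tens (U : lmodType k) (f : V -> W -> U) v w :
  bilinear_for *:%R *:%R f -> tlift f (tens v w) = f v w.
Proof. by move=> bf; rewrite /tens tlift_pi// /formal_eval big_seq1. Qed.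

Lemma tens_bilinear : bilinear_for *:%R *:%R tens.
Proof.
split=> [w|v] c x y; apply: tlift_inj => U f bf;
  by rewrite tlift_linear// !tlift_tens// bf.
Qed.

Lemma tensDl v1 v2 w : tens (v1 + v2) w = tens v1 w + tens v2 w.
Proof. by have /= := tens_bilinear.1 w 1 v1 v2; rewrite !scale1r. Qed.
Lemma tensDr v w1 w2 : tens v (w1 + w2) = tens v w1 + tens v w2.
Proof. by have /= := tens_bilinear.2 v 1 w1 w2; rewrite !scale1r. Qed.
Lemma tensZl c v w : tens (c *: v) w = c *: tens v w.
Proof. exact: bilinZl tens_bilinear c v w. Qed.
Lemma tens0r v : tens v 0 = 0.
Proof. by apply: (addIr (tens v 0)); rewrite -tensDr !add0r. Qed.
Lemma tensZr c v w : tens v (c *: w) = c *: tens v w.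
Proof. by have /= := tens_bilinear.2 v c w 0; rewrite tens0r !addr0. Qed.

Lemma tens_sum (t : tensor) : t = \sum_(p <- repr t) tens p.1 p.2.
Proof.
apply: tlift_inj => U f bf.
pose F : {linear tensor -> U} := HB.pack (tlift f)
  (GRing.isLinear.Build k tensor U *:%R (tlift f) (tlift_linear bf)).
rewrite -[RHS]/(F _) linear_sum; apply: eq_bigr => p _ /=.
by rewrite tlift_tens.
Qed.

Lemma tens_ind (P : tensor -> Prop) :
  P 0 -> (forall x y, P x -> P y -> P (x + y)) -> (forall v w, P (tens v w)) ->
  forall t, P t.
Proof.
by move=> P0 PD Pt t; rewrite [t]tens_sum; apply: big_ind => // p _.
Qed.

End Tensor.

Arguments tens {k V W} v w.
Arguments tlift {k V W U} f t.
Notation "V ⊗ W" := (tensor V%type W%type) : type_scope.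
Notation "v ⊗ w" := (tens v w) : ring_scope.

Lemma tens_linear_ext (k : fieldType) (V W U : lmodType k)
    (f g : V ⊗ W -> U) : linear f -> linear g ->
  (forall v w, f (v ⊗ w) = g (v ⊗ w)) -> f =1 g.
Proof.
move=> lf lg E.
pose F : {linear (V ⊗ W)%type -> U} :=
  HB.pack f (GRing.isLinear.Build k (tensor V W) U *:%R f lf).
pose G : {linear (V ⊗ W)%type -> U} :=
  HB.pack g (GRing.isLinear.Build k (tensor V W) U *:%R g lg).
suff FG : F =1 G by [].
elim/tens_ind => [|x y Ex Ey|v w]; first by rewrite !linear0.
  by rewrite !linearD Ex Ey.
exact: E.
Qed.

Section TensorMaps.
Variable k : fieldType.

Definition tmap (V W V' W' : lmodType k) (f : V -> V') (g : W -> W') :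
    V ⊗ W -> V' ⊗ W' :=
  tlift (fun v w => f v ⊗ g w).

Lemma tmap_bilinear (V W V' W' : lmodType k)
    (f : {linear V -> V'}) (g : {linear W -> W'}) :
  bilinear_for *:%R *:%R (fun v w => f v ⊗ g w).
Proof. by split=> [w|v] c x y; rewrite linearP tens_bilinear. Qed.

Lemma tmap_tens (V W V' W' : lmodType k)
    (f : {linear V -> V'}) (g : {linear W -> W'}) v w :
  tmap f g (v ⊗ w) = f v ⊗ g w.
Proof. exact: tlift_tens (tmap_bilinear f g). Qed.

HB.instance Definition _ (V W V' W' : lmodType k)
    (f : {linear V -> V'}) (g : {linear W -> W'}) :=
  GRing.isLinear.Build k (tensor V W) (tensor V' W') *:%R (tmap f g)
    (tlift_linear (tmap_bilinear f g)).

Definition tassoc (V W X : lmodType k) : V ⊗ (W ⊗ X) -> (V ⊗ W) ⊗ X :=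
  tlift (fun v t => tlift (fun w x => (v ⊗ w) ⊗ x) t).

Let tassoc_bilinear1 (V W X : lmodType k) (v : V) :
  bilinear_for *:%R *:%R (fun (w : W) (x : X) => (v ⊗ w) ⊗ x).
Proof. by split=> [w|w] c x y; rewrite ?tens_bilinear. Qed.

Let tassoc_bilinear (V W X : lmodType k) :
  bilinear_for *:%R *:%R
    (fun (v : V) (t : W ⊗ X) => tlift (fun w x => (v ⊗ w) ⊗ x) t).
Proof.
split=> [t|v]; last exact/tlift_linear/tassoc_bilinear1.
move=> c v v'; rewrite /tlift /formal_eval /= scaler_sumr -big_split /=.
by apply: eq_bigr => p _; rewrite !tens_bilinear.
Qed.

Lemma tassoc_tens (V W X : lmodType k) (v : V) (w : W) (x : X) :
  tassoc (v ⊗ (w ⊗ x)) = (v ⊗ w) ⊗ x.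
Proof. by rewrite /tassoc tlift_tens// tlift_tens. Qed.

HB.instance Definition _ (V W X : lmodType k) :=
  GRing.isLinear.Build k (tensor V (tensor W X)) (tensor (tensor V W) X) *:%R (@tassoc V W X)
    (tlift_linear (@tassoc_bilinear V W X)).

End TensorMaps.

(** * Tensor product of two algebras *)

Section TensorAlgebra.
Variables (k : fieldType) (A B : pzAlgType k).
Implicit Types x y z : A ⊗ B.

Definition tmul x y : A ⊗ B :=
  tlift (fun (a : A) (b : B) => tlift (fun (c : A) (d : B) => (a * c) ⊗ (b * d)) y) x.

Let mul_bilinear1 (a : A) (b : B) :
  bilinear_for *:%R *:%R (fun (c : A) (d : B) => (a * c) ⊗ (b * d)).
Proof.
by split=> [w|w] c x y; rewrite mulrDr -pzscalerAr tens_bilinear.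
Qed.

Let mul_bilinear y : bilinear_for *:%R *:%R
  (fun (a : A) (b : B) => tlift (fun (c : A) (d : B) => (a * c) ⊗ (b * d)) y).
Proof.
split=> [w|w] c u v; rewrite /tlift /formal_eval /= scaler_sumr -big_split /=;
  by apply: eq_bigr => p _; rewrite mulrDl -pzscalerAl tens_bilinear.
Qed.

Lemma tmul_tens a b c d : tmul (a ⊗ b) (c ⊗ d) = (a * c) ⊗ (b * d).
Proof. by rewrite /tmul tlift_tens// tlift_tens. Qed.

Lemma tmul_bilinear : bilinear_for *:%R *:%R tmul.
Proof.
split=> [y|x c y z]; first exact/tlift_linear/mul_bilinear.
rewrite /tmul [LHS]/tlift [in RHS]/tlift /formal_eval /= scaler_sumr -big_split /=.
by apply: eq_bigr => p _; rewrite tlift_linear.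
Qed.

Let tmulDl : left_distributive tmul +%R.
Proof. by move=> x y z; have /= := tmul_bilinear.1 z 1 x y; rewrite !scale1r. Qed.
Let tmulDr : right_distributive tmul +%R.
Proof. by move=> x y z; have /= := tmul_bilinear.2 x 1 y z; rewrite !scale1r. Qed.
Let tmul0l x : tmul 0 x = 0.
Proof. by apply: (addIr (tmul 0 x)); rewrite -tmulDl !add0r. Qed.
Let tmul0r x : tmul x 0 = 0.
Proof. by apply: (addIr (tmul x 0)); rewrite -tmulDr !add0r. Qed.

Let tmulA : associative tmul.
Proof.
move=> x y z; elim/tens_ind: x => [|x x' Ex Ex'|a b]; first by rewrite !tmul0l.
  by rewrite !tmulDl Ex Ex'.
elim/tens_ind: y => [|y y' Ey Ey'|c d]; first by rewrite !(tmul0l, tmul0r).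
  by rewrite !(tmulDl, tmulDr) Ey Ey'.
elim/tens_ind: z => [|z z' Ez Ez'|e f]; first by rewrite !tmul0r.
  by rewrite !tmulDr Ez Ez'.
by rewrite !tmul_tens !mulrA.
Qed.

Let tmul1l : left_id ((1 : A) ⊗ (1 : B)) tmul.
Proof.
elim/tens_ind => [|x y Ex Ey|a b]; first by rewrite tmul0r.
  by rewrite tmulDr Ex Ey.
by rewrite tmul_tens !mul1r.
Qed.

Let tmul1r : right_id ((1 : A) ⊗ (1 : B)) tmul.
Proof.
elim/tens_ind => [|x y Ex Ey|a b]; first by rewrite tmul0l.
  by rewrite tmulDl Ex Ey.
by rewrite tmul_tens !mulr1.
Qed.

Let tscaleAl (c : k) x y : c *: tmul x y = tmul (c *: x) y.
Proof. by have /= := tmul_bilinear.1 y c x 0; rewrite tmul0l !addr0. Qed.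
Let tscaleAr (c : k) x y : c *: tmul x y = tmul x (c *: y).
Proof. by have /= := tmul_bilinear.2 x c y 0; rewrite tmul0r !addr0. Qed.

HB.instance Definition _ :=
  Lmodule_isPzAlgebra.Build k (tensor A B)
    tmulA tmul1l tmul1r tmulDl tmulDr tscaleAl tscaleAr.
HB.instance Definition _ :=
  GRing.Zmodule_isPzRing.Build (tensor A B) tmulA tmul1l tmul1r tmulDl tmulDr.

Lemma mul_tens (a c : A) (b d : B) :
  (a ⊗ b) * (c ⊗ d) = (a * c) ⊗ (b * d) :> (A ⊗ B)%type.
Proof. exact: tmul_tens. Qed.

Lemma one_tens : 1 = (1 : A) ⊗ (1 : B) :> (A ⊗ B)%type.
Proof. by []. Qed.

End TensorAlgebra.

(** * Weak bialgebras and weak Hopf algebras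
    [H ⊗ (H ⊗ H)] is identified with [(H ⊗ H) ⊗ H] through [tassoc]; [k ⊗ H] and
    [H ⊗ k] are identified with [H] through scaling, so that [contractl e] is
    [e ⊗ id] and [contractr e] is [id ⊗ e]. A [weak_hopf_algebra H] is a weak Hopf
    structure on the algebra [H]: two of them share their algebra structure. *)

Section WeakHopf.
Variables (k : fieldType) (H : pzAlgType k).

Definition contractl (e : H -> k) : H ⊗ H -> H :=
  tlift (fun a b : H => e a *: b).
Definition contractr (e : H -> k) : H ⊗ H -> H :=
  tlift (fun a b : H => e b *: a).

Record weak_bialgebra := WeakBialgebra {
  comul : {linear H -> (H ⊗ H)%type};
  counit : {scalar H};
  comulA : forall h,
    tmap comul idfun (comul h) = tassoc (tmap idfun comul (comul h));
  counit_comull : forall h, contractl counit (comul h) = h;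
  counit_comulr : forall h, contractr counit (comul h) = h;
  comulM : forall h g, comul (h * g) = comul h * comul g;
  counitM12 : forall h g f, counit (h * g * f) =
    tlift (fun g1 g2 : H => counit (h * g1) * counit (g2 * f)) (comul g);
  counitM21 : forall h g f, counit (h * g * f) =
    tlift (fun g1 g2 : H => counit (h * g2) * counit (g1 * f)) (comul g);
  comul1_lr : tmap comul idfun (comul 1) =
    (comul 1 ⊗ (1 : H)) * tassoc ((1 : H) ⊗ comul 1);
  comul1_rl : tmap comul idfun (comul 1) =
    tassoc ((1 : H) ⊗ comul 1) * (comul 1 ⊗ (1 : H))
}.

Record weak_hopf_algebra := WeakHopfAlgebra {
  whopf_bialgebra :> weak_bialgebra;
  antipode : {linear H -> H};
  antipode_r : forall h,
    tlift (fun h1 h2 : H => h1 * antipode h2) (comul whopf_bialgebra h) =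
    contractl (counit whopf_bialgebra)
      (comul whopf_bialgebra 1 * (h ⊗ (1 : H)));
  antipode_l : forall h,
    tlift (fun h1 h2 : H => antipode h1 * h2) (comul whopf_bialgebra h) =
    contractr (counit whopf_bialgebra)
      (((1 : H) ⊗ h) * comul whopf_bialgebra 1);
  antipode_lr : forall h,
    tlift (fun (h12 : (H ⊗ H)%type) (h3 : H) =>
             tlift (fun h1 h2 : H => antipode h1 * h2 * antipode h3) h12)
      (tmap (comul whopf_bialgebra) idfun (comul whopf_bialgebra h)) =
    antipode h
}.

Record is_twist (A : weak_hopf_algebra) (T Tb : H ⊗ H) : Prop := IsTwist {
  twist_range : exists x, T = comul A 1 * x;
  twist_bar_range : exists x, Tb = x * comul A 1;
  twist_mul_bar : T * Tb = comul A 1;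
  twist_counitl : contractl (counit A) T = 1;
  twist_counitr : contractr (counit A) T = 1;
  twist_bar_counitl : contractl (counit A) Tb = 1;
  twist_bar_counitr : contractr (counit A) Tb = 1;
  twist_cocycle :
    tmap (comul A) idfun T * (T ⊗ (1 : H)) =
    tassoc (tmap idfun (comul A) T) * tassoc ((1 : H) ⊗ T);
  twist_bar_cocycle :
    (Tb ⊗ (1 : H)) * tmap (comul A) idfun Tb =
    tassoc ((1 : H) ⊗ Tb) * tassoc (tmap idfun (comul A) Tb);
  twist_mixed_lr :
    tmap (comul A) idfun Tb * tassoc (tmap idfun (comul A) T) =
    (T ⊗ (1 : H)) * tassoc ((1 : H) ⊗ Tb);
  twist_mixed_rl :
    tassoc (tmap idfun (comul A) Tb) * tmap (comul A) idfun T =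
    tassoc ((1 : H) ⊗ T) * (Tb ⊗ (1 : H))
}.

End WeakHopf.

(* Main.v *)
From HB Require Import structures.
Require Import Defs.
From mathcomp Require Import all_boot all_algebra.
Import GRing.Theory.

(** Sweedler notation is used throughout: [h_1 ⊗ h_2] is [Δ h], and [T_1 ⊗ T_2],
    [Tb_1 ⊗ Tb_2] are the twist and its partner.

    In an ordinary Hopf algebra the proof is a direct computation in which
    [h_1 S(h_2)] and [S(h_1) h_2] are scalars. Here they are the target and source
    counital maps [εt] and [εs]. What saves the computation is that the values
    of [εt] and [εs] commute with each other ([target_source_comm]) and can be
    moved in and out of [Δ] on one leg; that [S] reverses products ([antipodeM]);
    and that on the counital subalgebras [S] is given by [εt] and [εs]
    ([antipode_source], [antipode_target]).

    The multiplicativity of the twisted comultiplication follows from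
    [T * Tb = Δ 1]; its coassociativity and the two factorisations of its value
    on [1] are the cocycle and mixed identities of the twist, read in the
    algebra [(H ⊗ H) ⊗ H]. For the axioms on the counit, [ε] applied to one leg
    of [Tb * Δ h * T] turns [T] and [Tb] into counital images
    ([sw_twisted_counitl], [sw_twisted_counitr]), and the normalisations of the
    twist, in the form [εt(T_1) T_2 = 1] and its three analogues, remove them.

    The inverse of [v = S(T_1) T_2] is [vinv = Tb_1 S(Tb_2)]. Both products of
    these are evaluated by a mixed identity, which replaces [T_2 Tb_1] or
    [T_1 Tb_2] by comultiplications; the antipode axioms then leave counital
    images that commute, and the sum factors as a product of two
    normalisations. The same computation with an extra counital element
    inserted ([twist_sandwich]) evaluates [h_1 ST(h_2)] and [ST(h_1) h_2] for the
    conjugated antipode [ST]. The third antipode axiom follows from these two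
    because [ST] reverses products. *)

Set Implicit Arguments.
Unset Strict Implicit.
Unset Printing Implicit Defensive.
Local Open Scope ring_scope.

Reserved Notation "\sw_ ( a , b <- t ) E"
  (at level 41, E at level 41, a name, b name, t at level 60,
   format "'[' \sw_ ( a ,  b  <-  t ) '/  '  E ']'").

(** * Multilinear expressions and Sweedler sums *)

Section Multilinear.
Variable k : fieldType.
Local Notation "\sw_ ( a , b <- t ) E" := (tlift (fun a b => E) t).
Implicit Types U V W X Y : lmodType k.

(** Linearity as a head constant, so that a tactic can match on it. *)
Definition lin U V (f : U -> V) := linear f.
Definition bilin U V W (f : U -> V -> W) :=
  (forall v, lin (f^~ v)) /\ (forall u, lin (f u)).
Definition trilin U V W X (f : U -> V -> W -> X) :=
  [/\ forall v w, lin (fun u => f u v w), forall u w, lin (fun v => f u v w)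
    & forall u v, lin (f u v)].

Lemma bilinP U V W (f : U -> V -> W) : bilin f -> bilinear_for *:%R *:%R f.
Proof. by case=> l r; split. Qed.

Lemma linZ U V (f : U -> V) c u : lin f -> f (c *: u) = c *: f u.
Proof.
move=> lf; pose F : {linear U -> V} :=
  HB.pack f (GRing.isLinear.Build k U V *:%R f lf).
exact: (linearZZ F).
Qed.

Lemma lin_id U : lin (fun u : U => u).
Proof. by []. Qed.
Lemma lin_comp U V W (g : V -> W) (f : U -> V) :
  lin g -> lin f -> lin (fun u => g (f u)).
Proof. by move=> lg lf c u v; rewrite lf lg. Qed.
Lemma lin_linear U V (f : {linear U -> V}) : lin f.
Proof. exact: linearP. Qed.
Lemma lin_scalar U (f : {scalar U}) : lin (f : U -> k^o).
Proof. exact: linearP. Qed.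
Lemma lin_scaler U V (c : k) (f : U -> V) : lin f -> lin (fun u => c *: f u).
Proof. by move=> lf d u v; rewrite lf scalerDr !scalerA mulrC. Qed.
Lemma lin_scalel U V (f : U -> k^o) (v : V) : lin f -> lin (fun u => f u *: v).
Proof. by move=> lf d u w; rewrite lf scalerDl scalerA. Qed.
Lemma lin_mull U (A : pzAlgType k) (a : A) (f : U -> A) :
  lin f -> lin (fun u => f u * a).
Proof. by move=> lf d u w; rewrite lf mulrDl pzscalerAl. Qed.
Lemma lin_mulr U (A : pzAlgType k) (a : A) (f : U -> A) :
  lin f -> lin (fun u => a * f u).
Proof. by move=> lf d u w; rewrite lf mulrDr pzscalerAr. Qed.
Lemma lin_tensl U V W (f : U -> V) (w : W) : lin f -> lin (fun u => f u ⊗ w).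
Proof. by move=> lf d u v; rewrite lf tensDl tensZl. Qed.
Lemma lin_tensr U V W (f : U -> V) (w : W) : lin f -> lin (fun u => w ⊗ f u).
Proof. by move=> lf d u v; rewrite lf tensDr tensZr. Qed.
Lemma lin_tlift U V W X (f : V -> W -> X) (t : U -> (V ⊗ W)%type) :
  bilin f -> lin t -> lin (fun u => tlift f (t u)).
Proof. by move=> /bilinP bf lt d u v; rewrite lt tlift_linear. Qed.
Lemma lin_tliftf U V W X (f : U -> V -> W -> X) (t : (V ⊗ W)%type) :
  (forall v w, lin (fun u => f u v w)) -> lin (fun u => tlift (f u) t).
Proof.
move=> lf d u v; rewrite /tlift /formal_eval scaler_sumr -big_split /=.
by apply: eq_bigr => p _; rewrite lf.
Qed.

Lemma trilin1 U V W X Y (g : U -> V -> W -> X) (f : Y -> U) v w :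
  trilin g -> lin f -> lin (fun y => g (f y) v w).
Proof. by case=> l _ _ lf; apply: (lin_comp (l v w)). Qed.
Lemma trilin2 U V W X Y (g : U -> V -> W -> X) (f : Y -> V) u w :
  trilin g -> lin f -> lin (fun y => g u (f y) w).
Proof. by case=> _ l _ lf; apply: (lin_comp (l u w)). Qed.
Lemma trilin3 U V W X Y (g : U -> V -> W -> X) (f : Y -> W) u v :
  trilin g -> lin f -> lin (fun y => g u v (f y)).
Proof. by case=> _ _ l lf; apply: (lin_comp (l u v)). Qed.
Lemma bilin1 U V W X (g : U -> V -> W) (f : X -> U) v :
  bilin g -> lin f -> lin (fun y => g (f y) v).
Proof. by case=> l _ lf; apply: (lin_comp (l v)). Qed.
Lemma bilin2 U V W X (g : U -> V -> W) (f : X -> V) u :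
  bilin g -> lin f -> lin (fun y => g u (f y)).
Proof. by case=> _ l lf; apply: (lin_comp (l u)). Qed.

Lemma lin_tassoc U V W X (f : U -> (V ⊗ (W ⊗ X))%type) :
  lin f -> lin (fun u => tassoc (f u)).
Proof. exact: (lin_comp (lin_linear (@tassoc k V W X))). Qed.
Lemma lin_tmap U V W X Y (g : {linear V -> X}) (h : {linear W -> Y})
    (f : U -> (V ⊗ W)%type) :
  lin f -> lin (fun u => tmap g h (f u)).
Proof. exact: (lin_comp (lin_linear (tmap g h))). Qed.

Lemma eq_tlift V W (U : zmodType) (f g : V -> W -> U) t :
  (forall v w, f v w = g v w) -> tlift f t = tlift g t.
Proof. by move=> E; apply: eq_bigr => p _. Qed.

(** Sweedler sums are finite sums over a representative, so a linear map goes
    through them whatever the summand is: bilinearity matters only when the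
    tensor [t] is rewritten. *)
Lemma lin_sw U V W X (g : W -> X) (f : U -> V -> W) t :
  lin g -> g (tlift f t) = \sw_(u, v <- t) g (f u v).
Proof.
move=> lg; pose G : {linear W -> X} :=
  HB.pack g (GRing.isLinear.Build k W X *:%R g lg).
exact: (linear_sum G).
Qed.

Lemma sw_mull V W (A : pzAlgType k) (f : V -> W -> A) t a :
  tlift f t * a = \sw_(u, v <- t) f u v * a.
Proof. exact: mulr_suml. Qed.
Lemma sw_mulr V W (A : pzAlgType k) (f : V -> W -> A) t a :
  a * tlift f t = \sw_(u, v <- t) a * f u v.
Proof. exact: mulr_sumr. Qed.

Lemma sw_exchange V W V' W' (U : zmodType) (f : V -> W -> V' -> W' -> U) s t :
  \sw_(a, b <- s) \sw_(c, d <- t) f a b c d =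
  \sw_(c, d <- t) \sw_(a, b <- s) f a b c d.
Proof. exact: exchange_big. Qed.

Lemma sw_tens V W X (f : V -> W -> X) v w : bilin f -> tlift f (v ⊗ w) = f v w.
Proof. by move=> /bilinP bf; rewrite tlift_tens. Qed.

Lemma sw_id V W (t : (V ⊗ W)%type) : \sw_(a, b <- t) a ⊗ b = t.
Proof. by rewrite [RHS]tens_sum. Qed.

Lemma lin_tens_ext V W X (F G : V ⊗ W -> X) : lin F -> lin G ->
  (forall v w, F (v ⊗ w) = G (v ⊗ w)) -> forall t, F t = G t.
Proof.
by move=> lF lG E t; rewrite -[t]sw_id !lin_sw//; apply: eq_tlift => v w; apply: E.
Qed.

End Multilinear.

(** Proves (multi)linearity of an expression by following its syntax, using
    linear and multilinear hypotheses found in the context. Metavariables that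
    are not applied to the bound variable cannot mention it, which is how the
    linear argument of a product is told from the constant one. *)
Ltac multilin :=
  lazymatch goal with
  | |- trilin _ => split => ? ? /=; multilin
  | |- bilin _ => split => ? /=; multilin
  | |- lin _ =>
    first [ assumption | exact: lin_linear | exact: lin_scalar |
    lazymatch goal with
    | |- lin (fun x => _) => fail
    | |- lin ?g => change (lin (fun x => g x)); multilin
    end |
    match goal with
    | |- lin (fun x => x) => exact: lin_id
    | |- lin (fun x => tlift (fun a b => @?F x a b) ?t) =>
        apply: lin_tliftf => ? ? /=; multilin
    | |- lin (fun x => tlift ?F (@?t x)) => apply: lin_tlift; multilin
    | |- lin (fun x => ?c *: @?f x) => apply: lin_scaler; multilin
    | |- lin (fun x => @?f x *: ?c) => apply: lin_scalel; multilin
    | |- lin (fun x => ?c ⊗ @?f x) => apply: lin_tensr; multilin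
    | |- lin (fun x => @?f x ⊗ ?c) => apply: lin_tensl; multilin
    | |- lin (fun x => ?c * @?f x) =>
        apply: lin_mulr; multilin
    | |- lin (fun x => @?f x * ?c) =>
        apply: lin_mull; multilin
    | |- lin (fun x => GRing.Linear.sort ?L (@?f x)) =>
        first [apply: (lin_comp (lin_linear L)) | apply: (lin_comp (lin_scalar L))];
        multilin
    | H : trilin ?g |- lin (fun x => ?g (@?f x) ?c ?d) =>
        apply: (trilin1 _ _ H); multilin
    | H : trilin ?g |- lin (fun x => ?g ?c (@?f x) ?d) =>
        apply: (trilin2 _ _ H); multilin
    | H : trilin ?g |- lin (fun x => ?g ?c ?d (@?f x)) =>
        apply: (trilin3 _ _ H); multilin
    | H : bilin ?g |- lin (fun x => ?g (@?f x) ?c) =>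
        apply: (bilin1 _ H); multilin
    | H : bilin ?g |- lin (fun x => ?g ?c (@?f x)) =>
        apply: (bilin2 _ H); multilin
    | |- lin (fun x => tassoc (@?f x)) => apply: lin_tassoc; multilin
    | |- lin (fun x => tmap ?g ?h (@?f x)) => apply: lin_tmap; multilin
    | H : lin ?g |- lin (fun x => ?g (@?f x)) =>
        apply: (lin_comp H); multilin
    end ]
  end.

(** * Sweedler sums over products and three-fold tensors *)

Section Tensor3.
Variables (k : fieldType) (H : pzAlgType k).
Local Notation "\sw_ ( a , b <- t ) E" := (tlift (fun a b : H => E) t).
Implicit Types (U : lmodType k).

Lemma sw_mul U (f : H -> H -> U) (s t : (H ⊗ H)%type) : bilin f ->
  tlift f (s * t) = \sw_(a, b <- s) \sw_(c, d <- t) f (a * c) (b * d).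
Proof.
move=> bf; have lf : lin (tlift f) by multilin.
rewrite -{1}[s]sw_id sw_mull lin_sw//; apply: eq_tlift => a b.
rewrite -{1}[t]sw_id sw_mulr lin_sw//; apply: eq_tlift => c d.
by rewrite mul_tens sw_tens.
Qed.

(** The Sweedler sum of a trilinear expression over an element of the third
    tensor power: applying it to both sides turns an identity between
    three-fold tensors into one between iterated Sweedler sums. *)
Definition tlift3 U (f : H -> H -> H -> U) (t : ((H ⊗ H) ⊗ H)%type) : U :=
  tlift (fun (x : (H ⊗ H)%type) (c : H) => \sw_(a, b <- x) f a b c) t.

Lemma lin_tlift3 U (f : H -> H -> H -> U) : trilin f -> lin (tlift3 f).
Proof. move=> tf; rewrite /tlift3; multilin. Qed.

Lemma tlift3_tensr U (f : H -> H -> H -> U) x c : trilin f ->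
  tlift3 f (x ⊗ c) = \sw_(a, b <- x) f a b c.
Proof. by move=> tf; rewrite /tlift3 sw_tens//; multilin. Qed.

Lemma tlift3_assoc U (f : H -> H -> H -> U) x a : trilin f ->
  tlift3 f (tassoc (a ⊗ x)) = \sw_(b, c <- x) f a b c.
Proof.
move=> tf; have lf := lin_tlift3 tf.
rewrite -{1}[x]sw_id.
rewrite (@lin_sw _ _ _ _ _ (fun y => tlift3 f (tassoc (a ⊗ y)))); last by multilin.
by apply: eq_tlift => b c; rewrite tassoc_tens tlift3_tensr// sw_tens//; multilin.
Qed.

Lemma tlift3_comull U (f : H -> H -> H -> U) (D : {linear H -> (H ⊗ H)%type}) t :
  trilin f -> tlift3 f (tmap D idfun t) =
    \sw_(a, b <- t) \sw_(a1, a2 <- D a) f a1 a2 b.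
Proof.
move=> tf; have lf := lin_tlift3 tf; rewrite /tmap lin_sw//.
by apply: eq_tlift => a b; rewrite tlift3_tensr.
Qed.

Lemma tlift3_comulr U (f : H -> H -> H -> U) (D : {linear H -> (H ⊗ H)%type}) t :
  trilin f -> tlift3 f (tassoc (tmap idfun D t)) =
    \sw_(a, b <- t) \sw_(b1, b2 <- D b) f a b1 b2.
Proof.
move=> tf; have lf := lin_tlift3 tf; rewrite /tmap.
rewrite (@lin_sw _ _ _ _ _ (fun y => tlift3 f (tassoc y))); last by multilin.
by apply: eq_tlift => a b; rewrite tlift3_assoc.
Qed.

Lemma tlift3_mul U (f : H -> H -> H -> U) (s t : ((H ⊗ H) ⊗ H)%type) : trilin f ->
  tlift3 f (s * t) =
    tlift3 (fun a b c => tlift3 (fun a' b' c' => f (a * a') (b * b') (c * c')) t) s.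
Proof.
move=> tf; have lf := lin_tlift3 tf.
rewrite -{1}[s]sw_id sw_mull lin_sw//; apply: eq_tlift => x c.
rewrite -{1}[t]sw_id sw_mulr lin_sw//.
rewrite [RHS]sw_exchange; apply: eq_tlift => y c'.
rewrite mul_tens tlift3_tensr// sw_mul//; multilin.
Qed.

Lemma tlift3_mul_lr U (f : H -> H -> H -> U) (s t : (H ⊗ H)%type) : trilin f ->
  tlift3 f ((s ⊗ (1 : H)) * tassoc ((1 : H) ⊗ t)) =
    \sw_(a, b <- s) \sw_(c, d <- t) f a (b * c) d.
Proof.
move=> tf; rewrite tlift3_mul// tlift3_tensr; last by rewrite /tlift3; multilin.
apply: eq_tlift => a b; rewrite tlift3_assoc; last by multilin.
by apply: eq_tlift => c d; rewrite mulr1 mul1r.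
Qed.

Lemma tlift3_mul_rl U (f : H -> H -> H -> U) (s t : (H ⊗ H)%type) : trilin f ->
  tlift3 f (tassoc ((1 : H) ⊗ t) * (s ⊗ (1 : H))) =
    \sw_(c, d <- t) \sw_(a, b <- s) f a (c * b) d.
Proof.
move=> tf; rewrite tlift3_mul// tlift3_assoc; last by rewrite /tlift3; multilin.
apply: eq_tlift => a b; rewrite tlift3_tensr; last by multilin.
by apply: eq_tlift => c d; rewrite mulr1 mul1r.
Qed.

End Tensor3.

(** * Counital maps of a weak bialgebra *)

Section WeakBialgebra.
Variables (k : fieldType) (H : pzAlgType k) (B : weak_bialgebra H).
Implicit Types (U : lmodType k) (g h x y z w : H).
Local Notation "\sw_ ( a , b <- t ) E" := (tlift (fun a b : H => E) t).
Local Notation Δ := (comul B).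
Local Notation ε := (counit B).

(** The target and source counital maps, [1_2 ε(1_1 h)] and [1_1 ε(h 1_2)]; the
    primed maps have the argument of the counit in the opposite order. The
    counit axioms of a weak bialgebra are statements about these four maps,
    which replace the map [h |-> ε(h) 1] of an ordinary bialgebra. *)
Definition target_map h := \sw_(a, b <- Δ 1) ε (a * h) *: b.
Definition source_map h := \sw_(a, b <- Δ 1) ε (h * b) *: a.
Definition target_map' h := \sw_(a, b <- Δ 1) ε (h * a) *: b.
Definition source_map' h := \sw_(a, b <- Δ 1) ε (b * h) *: a.
Local Notation εt := target_map.
Local Notation εs := source_map.
Local Notation εt' := target_map'.
Local Notation εs' := source_map'.

(** The target and source counital subalgebras, described by the way their
    elements commute with the comultiplication. This form is what Sweedler
    computations consume: such an element can be moved in and out of [Δ]. *)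
Definition in_target z :=
  Δ z = (z ⊗ (1 : H)) * Δ 1 /\ Δ z = Δ 1 * (z ⊗ (1 : H)).
Definition in_source w :=
  Δ w = ((1 : H) ⊗ w) * Δ 1 /\ Δ w = Δ 1 * ((1 : H) ⊗ w).

Lemma sw_coassoc U (f : H -> H -> H -> U) h : trilin f ->
  \sw_(a, b <- Δ h) \sw_(a1, a2 <- Δ a) f a1 a2 b =
  \sw_(a, b <- Δ h) \sw_(b1, b2 <- Δ b) f a b1 b2.
Proof. by move=> tf; rewrite -tlift3_comull// comulA tlift3_comulr. Qed.

Lemma sw_counitl U (f : H -> U) h : lin f ->
  \sw_(a, b <- Δ h) ε a *: f b = f h.
Proof.
move=> lf; rewrite -[in RHS](counit_comull B h) /contractl lin_sw//.
by apply: eq_tlift => a b; rewrite linZ.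
Qed.

Lemma sw_counitr U (f : H -> U) h : lin f ->
  \sw_(a, b <- Δ h) ε b *: f a = f h.
Proof.
move=> lf; rewrite -[in RHS](counit_comulr B h) /contractr lin_sw//.
by apply: eq_tlift => a b; rewrite linZ.
Qed.

Lemma sw_comul1_lr U (f : H -> H -> H -> U) : trilin f ->
  \sw_(a, b <- Δ 1) \sw_(b1, b2 <- Δ b) f a b1 b2 =
  \sw_(a, b <- Δ 1) \sw_(c, d <- Δ 1) f a (b * c) d.
Proof.
by move=> tf; rewrite -tlift3_comulr// -comulA comul1_lr tlift3_mul_lr.
Qed.

Lemma sw_comul1_rl U (f : H -> H -> H -> U) : trilin f ->
  \sw_(a, b <- Δ 1) \sw_(b1, b2 <- Δ b) f a b1 b2 =
  \sw_(c, d <- Δ 1) \sw_(a, b <- Δ 1) f a (c * b) d.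
Proof.
by move=> tf; rewrite -tlift3_comulr// -comulA comul1_rl tlift3_mul_rl.
Qed.

Lemma comul1_mul h : Δ 1 * Δ h = Δ h.
Proof. by rewrite -comulM mul1r. Qed.
Lemma mul_comul1 h : Δ h * Δ 1 = Δ h.
Proof. by rewrite -comulM mulr1. Qed.

Lemma comul_inj g h : Δ g = Δ h -> g = h.
Proof. by move=> E; rewrite -(counit_comull B g) E counit_comull. Qed.

(** Contracting the first leg of [(Δ ⊗ id)(Δ 1)] leaves [Δ] of the contracted
    element on one side; on the other side the two factorisations of this
    three-fold tensor leave that element times [Δ 1], in either order. *)
Lemma in_target_contract (φ : H -> k) : lin (φ : H -> k^o) ->
  in_target (\sw_(a, b <- Δ 1) φ a *: b).
Proof.
move=> lφ.
have E : Δ (\sw_(a, b <- Δ 1) φ a *: b) =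
    \sw_(a, b <- Δ 1) \sw_(b1, b2 <- Δ b) (φ a *: (b1 ⊗ b2) : (H ⊗ H)%type).
  rewrite lin_sw; last by multilin.
  apply: eq_tlift => a b; rewrite linZ; last by multilin.
  rewrite -{1}[Δ b]sw_id lin_sw//; multilin.
have tf : trilin (fun a b c : H => φ a *: (b ⊗ c) : (H ⊗ H)%type) by multilin.
split; rewrite {}E.
- rewrite (sw_comul1_lr tf).
  rewrite [RHS](lin_sw (g := fun z => (z ⊗ (1 : H)) * Δ 1)); last by multilin.
  apply: eq_tlift => a b; rewrite -[in RHS](sw_id (Δ 1)) sw_mulr.
  by apply: eq_tlift => c d; rewrite mul_tens mul1r -pzscalerAl tensZl.
- rewrite (sw_comul1_rl tf).
  rewrite [RHS](lin_sw (g := fun z => Δ 1 * (z ⊗ (1 : H)))); last by multilin.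
  rewrite sw_exchange; apply: eq_tlift => a b.
  rewrite -[in RHS](sw_id (Δ 1)) sw_mull.
  by apply: eq_tlift => c d; rewrite mul_tens mulr1 -pzscalerAr tensZl.
Qed.

Lemma in_source_contract (φ : H -> k) : lin (φ : H -> k^o) ->
  in_source (\sw_(a, b <- Δ 1) φ b *: a).
Proof.
move=> lφ.
have tf : trilin (fun a b c : H => φ c *: (a ⊗ b) : (H ⊗ H)%type) by multilin.
have E : Δ (\sw_(a, b <- Δ 1) φ b *: a) =
    \sw_(a, b <- Δ 1) \sw_(b1, b2 <- Δ b) (φ b2 *: (a ⊗ b1) : (H ⊗ H)%type).
  rewrite -(sw_coassoc _ tf) lin_sw; last by multilin.
  apply: eq_tlift => a b; rewrite linZ; last by multilin.
  rewrite -{1}[Δ a]sw_id lin_sw//; multilin.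
split; rewrite {}E.
- rewrite (sw_comul1_rl tf).
  rewrite [RHS](lin_sw (g := fun z => ((1 : H) ⊗ z) * Δ 1)); last by multilin.
  apply: eq_tlift => a b; rewrite -[in RHS](sw_id (Δ 1)) sw_mulr.
  by apply: eq_tlift => c d; rewrite mul_tens mul1r -pzscalerAl tensZr.
- rewrite (sw_comul1_lr tf).
  rewrite [RHS](lin_sw (g := fun z => Δ 1 * ((1 : H) ⊗ z))); last by multilin.
  rewrite sw_exchange; apply: eq_tlift => a b.
  rewrite -[in RHS](sw_id (Δ 1)) sw_mull.
  by apply: eq_tlift => c d; rewrite mul_tens mulr1 -pzscalerAr tensZr.
Qed.

Lemma in_target_map h : in_target (εt h).
Proof. by apply: in_target_contract; multilin. Qed.
Lemma in_target_map' h : in_target (εt' h).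
Proof. by apply: in_target_contract; multilin. Qed.
Lemma in_source_map h : in_source (εs h).
Proof. by apply: in_source_contract; multilin. Qed.
Lemma in_source_map' h : in_source (εs' h).
Proof. by apply: in_source_contract; multilin. Qed.

(** Both products have the same image under [Δ], namely the two elements placed
    on the two legs of [Δ 1], and [Δ] is injective. *)
Lemma target_source_comm z w : in_target z -> in_source w -> z * w = w * z.
Proof.
move=> [zl zr] [wl _]; apply: comul_inj; rewrite !comulM.
have -> : Δ z * Δ w = (z ⊗ (1 : H)) * (((1 : H) ⊗ w) * Δ 1) :> (H ⊗ H)%type.
  by rewrite zl -mulrA comul1_mul wl.
have -> : Δ w * Δ z = ((1 : H) ⊗ w) * ((z ⊗ (1 : H)) * Δ 1) :> (H ⊗ H)%type.
  by rewrite wl -mulrA comul1_mul zl.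
by rewrite !mulrA !mul_tens !mul1r !mulr1.
Qed.

(** This and the three next lemmas are the counit axioms with [1] as middle
    factor: inside [ε] an outer factor may be replaced by its counital image. *)
Lemma counit_target g h : ε (g * εt h) = ε (g * h).
Proof.
rewrite /target_map sw_mulr (lin_sw (g := ε : H -> k^o)); last by multilin.
rewrite -[in RHS](mulr1 g) counitM21; apply: eq_tlift => a b.
by rewrite -pzscalerAr linearZ /= mulrC.
Qed.

Lemma counit_source' g h : ε (g * εs' h) = ε (g * h).
Proof.
rewrite /source_map' sw_mulr (lin_sw (g := ε : H -> k^o)); last by multilin.
rewrite -[in RHS](mulr1 g) counitM12; apply: eq_tlift => a b.
by rewrite -pzscalerAr linearZ /= mulrC.
Qed.

Lemma counit_source g h : ε (εs g * h) = ε (g * h).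
Proof.
rewrite /source_map sw_mull (lin_sw (g := ε : H -> k^o)); last by multilin.
rewrite -[in RHS](mulr1 g) counitM21; apply: eq_tlift => a b.
by rewrite -pzscalerAl linearZ.
Qed.

Lemma counit_target' g h : ε (εt' g * h) = ε (g * h).
Proof.
rewrite /target_map' sw_mull (lin_sw (g := ε : H -> k^o)); last by multilin.
rewrite -[in RHS](mulr1 g) counitM12; apply: eq_tlift => a b.
by rewrite -pzscalerAl linearZ.
Qed.

Lemma comul_mul_target h z : in_target z -> Δ (h * z) = Δ h * (z ⊗ (1 : H)).
Proof. by case=> _ zr; rewrite comulM zr mulrA mul_comul1. Qed.
Lemma comul_target_mul h z : in_target z -> Δ (z * h) = (z ⊗ (1 : H)) * Δ h.
Proof. by case=> zl _; rewrite comulM zl -mulrA comul1_mul. Qed.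
Lemma comul_mul_source h w : in_source w -> Δ (h * w) = Δ h * ((1 : H) ⊗ w).
Proof. by case=> _ wr; rewrite comulM wr mulrA mul_comul1. Qed.
Lemma comul_source_mul h w : in_source w -> Δ (w * h) = ((1 : H) ⊗ w) * Δ h.
Proof. by case=> wl _; rewrite comulM wl -mulrA comul1_mul. Qed.

Lemma sw_tensl_mul U (f : H -> H -> U) x y t : bilin f ->
  tlift f ((x ⊗ y) * t) = \sw_(a, b <- t) f (x * a) (y * b).
Proof. by move=> bf; rewrite sw_mul// sw_tens//; multilin. Qed.
Lemma sw_mul_tensr U (f : H -> H -> U) x y t : bilin f ->
  tlift f (t * (x ⊗ y)) = \sw_(a, b <- t) f (a * x) (b * y).
Proof.
by move=> bf; rewrite sw_mul//; apply: eq_tlift => a b; rewrite sw_tens//; multilin.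
Qed.

(** Replace [x] and [y] by counital images inside [ε]; these lie in the target
    subalgebra and so can be absorbed into [Δ], after which the counit axiom
    applies. *)
Lemma sw_counit_mull U (f : H -> U) x y h : lin f ->
  \sw_(a, b <- Δ h) ε (x * a * y) *: f b = f (εt' x * h * εt y).
Proof.
move=> lf; rewrite -sw_counitl// comul_mul_target; last exact: in_target_map.
rewrite comul_target_mul; last exact: in_target_map'.
rewrite sw_mul_tensr ?sw_tensl_mul; do ?by multilin.
by apply: eq_tlift => a b; rewrite mulr1 mul1r counit_target -!mulrA counit_target'.
Qed.

Lemma sw_counit_mulr U (f : H -> U) x y h : lin f ->
  \sw_(a, b <- Δ h) ε (x * b * y) *: f a = f (εs x * h * εs' y).
Proof.
move=> lf; rewrite -sw_counitr// comul_mul_source; last exact: in_source_map'.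
rewrite comul_source_mul; last exact: in_source_map.
rewrite sw_mul_tensr ?sw_tensl_mul; do ?by multilin.
by apply: eq_tlift => a b; rewrite mulr1 mul1r counit_source' -!mulrA counit_source.
Qed.

Lemma target_map1 : εt 1 = 1.
Proof.
rewrite -[RHS](counit_comull B 1); apply: eq_tlift => a b; by rewrite mulr1.
Qed.
Lemma source_map1 : εs 1 = 1.
Proof.
rewrite -[RHS](counit_comulr B 1); apply: eq_tlift => a b; by rewrite mul1r.
Qed.
Lemma source_map'1 : εs' 1 = 1.
Proof.
rewrite -[RHS](counit_comulr B 1); apply: eq_tlift => a b; by rewrite mulr1.
Qed.

Lemma in_target1 : in_target 1.
Proof. by rewrite -target_map1; apply: in_target_map. Qed.
Lemma in_source1 : in_source 1.
Proof. by rewrite -source_map1; apply: in_source_map. Qed.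

Lemma target_map_mul h g : εt (h * εt g) = εt (h * g).
Proof. by apply: eq_tlift => a b; rewrite !mulrA counit_target. Qed.
Lemma source_map_mul h g : εs (εs h * g) = εs (h * g).
Proof. by apply: eq_tlift => a b; rewrite -!mulrA counit_source. Qed.
Lemma target_map_source' h : εt (εs' h) = εt h.
Proof. by apply: eq_tlift => a b; rewrite counit_source'. Qed.
Lemma source_map_target' h : εs (εt' h) = εs h.
Proof. by apply: eq_tlift => a b; rewrite counit_target'. Qed.

(** Both sides are [ε(x h_1) ε(y h_2)]: the sum over [h] is evaluated on its
    first leg for the left side and on its second leg for the right side. *)
Lemma counit_target'_source x y h : ε (y * (εt' x * h)) = ε (x * (εs y * h)).
Proof.
transitivity (\sw_(a, b <- Δ h) (ε (x * a * 1) *: (ε (y * b) : k^o)) : k^o).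
  rewrite (sw_counit_mull (U := k^o) (f := fun b => ε (y * b))); last by multilin.
  by rewrite target_map1 mulr1.
transitivity (\sw_(a, b <- Δ h) (ε (y * b * 1) *: (ε (x * a) : k^o)) : k^o).
  by apply: eq_tlift => a b; rewrite /GRing.scale /= !mulr1 mulrC.
rewrite (sw_counit_mulr (U := k^o) (f := fun a => ε (x * a))); last by multilin.
by rewrite source_map'1 mulr1.
Qed.

Lemma lin_target_map : lin εt.
Proof. by rewrite /target_map; multilin. Qed.
Lemma lin_source_map : lin εs.
Proof. by rewrite /source_map; multilin. Qed.
Lemma lin_target_map' : lin εt'.
Proof. by rewrite /target_map'; multilin. Qed.
Lemma lin_source_map' : lin εs'.
Proof. by rewrite /source_map'; multilin. Qed.

Lemma target_mapE h : contractl ε (Δ 1 * (h ⊗ (1 : H))) = εt h.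
Proof.
rewrite /contractl sw_mul_tensr; last by multilin.
by apply: eq_tlift => a b; rewrite mulr1.
Qed.
Lemma source_mapE h : contractr ε (((1 : H) ⊗ h) * Δ 1) = εs h.
Proof.
rewrite /contractr sw_tensl_mul; last by multilin.
by apply: eq_tlift => a b; rewrite mul1r.
Qed.

(** This is [h_1 ⊗ εt(h_2) = 1_1 h ⊗ 1_2]. With [1'_1 ⊗ 1'_2] a second copy of
    [Δ 1], the left side is [h_1 ⊗ ε(1_1 h_2) 1_2], in which
    [1'_1 ⊗ 1_1 1'_2 ⊗ 1_2] can be inserted for free; that is [(Δ ⊗ id)(Δ 1)],
    and contracting its middle leg gives back [Δ 1]. *)
Lemma sw_target_map U (f : H -> H -> U) h : bilin f ->
  \sw_(a, b <- Δ h) f a (εt b) = \sw_(c, d <- Δ 1) f (c * h) d.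
Proof.
move=> bf.
have tf : trilin (fun a b c : H => ε b *: f a c : U) by multilin.
transitivity (tlift3 (fun a b c : H => ε b *: f a c : U)
  (tassoc ((1 : H) ⊗ Δ 1) * (Δ h ⊗ (1 : H)))).
  rewrite tlift3_mul_rl// sw_exchange; apply: eq_tlift => a b.
  rewrite /target_map lin_sw; last by multilin.
  by apply: eq_tlift => c d; rewrite linZ//; multilin.
(* [Δ h = Δ 1 * Δ h] supplies the second copy of [Δ 1] *)
have -> : tassoc ((1 : H) ⊗ Δ 1) * (Δ h ⊗ (1 : H)) =
    tmap (Δ) idfun (Δ 1) * (Δ h ⊗ (1 : H)) :> ((H ⊗ H) ⊗ H)%type.
  by rewrite comul1_rl -mulrA mul_tens comul1_mul mulr1.
rewrite tlift3_mul// tlift3_comull; last by rewrite /tlift3; multilin.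
apply: eq_tlift => c d; rewrite -[RHS](sw_counitr (f := fun y => f y d)); last by multilin.
rewrite comulM sw_mul; last by multilin.
apply: eq_tlift => c1 c2; rewrite tlift3_tensr; last by multilin.
by apply: eq_tlift => a b; rewrite mulr1.
Qed.

End WeakBialgebra.

(** * The antipode of a weak Hopf algebra *)

Section WeakHopf.
Variables (k : fieldType) (H : pzAlgType k) (A : weak_hopf_algebra H).
Implicit Types (U : lmodType k) (g h x y z w : H).
Local Notation "\sw_ ( a , b <- t ) E" := (tlift (fun a b : H => E) t).
Local Notation Δ := (comul A).
Local Notation ε := (counit A).
Local Notation S := (antipode A).
Local Notation εt := (target_map A).
Local Notation εs := (source_map A).
Local Notation εt' := (target_map' A).
Local Notation εs' := (source_map' A).

Let lt : lin εt. Proof. exact: lin_target_map. Qed.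
Let ls : lin εs. Proof. exact: lin_source_map. Qed.

Lemma sw_antipode_r h z : in_target A z ->
  \sw_(a, b <- Δ h) a * z * S b = εt (h * z).
Proof.
move=> tz; rewrite -target_mapE -antipode_r comul_mul_target//.
rewrite sw_mul_tensr; last by multilin.
by apply: eq_tlift => a b; rewrite mulr1.
Qed.

Lemma sw_antipode_l h w : in_source A w ->
  \sw_(a, b <- Δ h) S a * w * b = εs (w * h).
Proof.
move=> sw; rewrite -source_mapE -antipode_l comul_source_mul//.
rewrite sw_tensl_mul; last by multilin.
by apply: eq_tlift => a b; rewrite mul1r mulrA.
Qed.

Lemma antipode_rE h : \sw_(a, b <- Δ h) a * S b = εt h.
Proof. by rewrite antipode_r target_mapE. Qed.
Lemma antipode_lE h : \sw_(a, b <- Δ h) S a * b = εs h.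
Proof. by rewrite antipode_l source_mapE. Qed.

(** With coassociativity, the axiom [S h_1 h_2 S h_3 = S h] can be bracketed in two
    ways; each of them absorbs one of the other two antipode axioms. *)
Lemma sw_source_antipode h : \sw_(a, b <- Δ h) εs a * S b = S h.
Proof.
rewrite -[RHS]antipode_lr -/(tlift3 (fun a b c => S a * b * S c) _).
rewrite tlift3_comull; last by multilin.
by apply: eq_tlift => a b; rewrite -antipode_lE sw_mull.
Qed.

Lemma sw_antipode_target h : \sw_(a, b <- Δ h) S a * εt b = S h.
Proof.
rewrite -sw_source_antipode.
transitivity (\sw_(a, b <- Δ h) \sw_(b1, b2 <- Δ b) S a * b1 * S b2).
  apply: eq_tlift => a b; rewrite -antipode_rE sw_mulr.
  by apply: eq_tlift => c d; rewrite mulrA.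
rewrite -(sw_coassoc A (f := fun a b c => S a * b * S c)); last by multilin.
by apply: eq_tlift => a b; rewrite -antipode_lE sw_mull.
Qed.

Lemma antipode1 : S 1 = 1.
Proof.
rewrite -sw_antipode_target (sw_target_map A (f := fun a b => S a * b)); last by multilin.
rewrite -[RHS](source_map1 A) -antipode_lE.
by apply: eq_tlift => a b; rewrite mulr1.
Qed.

Lemma target_source_map_comm x y : εt x * εs y = εs y * εt x.
Proof. exact: target_source_comm (in_target_map _ _) (in_source_map _ _). Qed.

(** Expand [εt(b x)] as [b_1 εt(x) S b_2]. The resulting [S h_1 h_2] is a source
    counital element, so [εt x] can be moved past it to the front. *)
Lemma sw_antipode_target_mul h x :
  \sw_(a, b <- Δ h) S a * εt (b * x) = εt x * S h.
Proof.
have tx := in_target_map A x.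
transitivity (\sw_(a, b <- Δ h) \sw_(b1, b2 <- Δ b) S a * b1 * εt x * S b2).
  apply: eq_tlift => a b; rewrite -target_map_mul -sw_antipode_r// sw_mulr.
  by apply: eq_tlift => c d; rewrite !mulrA.
rewrite -(sw_coassoc A (f := fun a b c => S a * b * εt x * S c)); last by multilin.
rewrite -sw_source_antipode sw_mulr; apply: eq_tlift => a b.
by rewrite mulrA target_source_map_comm -antipode_lE !sw_mull.
Qed.

Lemma sw_source_mul_antipode h x :
  \sw_(a, b <- Δ h) εs (x * a) * S b = S h * εs x.
Proof.
have sx := in_source_map A x.
transitivity (\sw_(a, b <- Δ h) \sw_(a1, a2 <- Δ a) S a1 * εs x * a2 * S b).
  by apply: eq_tlift => a b; rewrite -source_map_mul -sw_antipode_l// sw_mull.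
rewrite (sw_coassoc A (f := fun a b c => S a * εs x * b * S c)); last by multilin.
rewrite -sw_antipode_target sw_mull; apply: eq_tlift => a b.
rewrite -[RHS]mulrA target_source_map_comm [RHS]mulrA -antipode_rE (sw_mulr _ (Δ b)).
by apply: eq_tlift => c d; rewrite !mulrA.
Qed.

(** On the source subalgebra the antipode is given by the target counital map:
    for [w] there, [S w = S w_1 εt(w_2) = S 1_1 εt(1_2 w) = εt(w) S 1]. *)
Lemma antipode_source w : in_source A w -> S w = εt w.
Proof.
case=> _ wr; rewrite -sw_antipode_target wr sw_mul_tensr; last by multilin.
transitivity (εt w * S 1); last by rewrite antipode1 mulr1.
rewrite -sw_antipode_target_mul.
by apply: eq_tlift => a b; rewrite mulr1.
Qed.

Lemma antipode_target z : in_target A z -> S z = εs z.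
Proof.
case=> zl _; rewrite -sw_source_antipode zl sw_tensl_mul; last by multilin.
transitivity (S 1 * εs z); last by rewrite antipode1 mul1r.
rewrite -sw_source_mul_antipode.
by apply: eq_tlift => a b; rewrite mul1r.
Qed.

Lemma antipode_source_map' x : S (εs' x) = εt x.
Proof.
by rewrite antipode_source ?target_map_source'//; apply: in_source_map'.
Qed.
Lemma antipode_target_map' x : S (εt' x) = εs x.
Proof.
by rewrite antipode_target ?source_map_target'//; apply: in_target_map'.
Qed.

(** Convolution of [(g, h) |-> S h * S g] with the multiplication; since
    [εs(g h)] is also the convolution of [(g, h) |-> S (g h)] with the
    multiplication, the two candidates for an antipode of a product agree
    there. *)
Lemma sw_antipode_mul_l g h :
  \sw_(a, b <- Δ g) \sw_(c, d <- Δ h) S c * S a * (b * d) = εs (g * h).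
Proof.
rewrite -source_map_mul -sw_antipode_l; last exact: in_source_map.
rewrite sw_exchange; apply: eq_tlift => c d.
rewrite -antipode_lE sw_mulr sw_mull.
by apply: eq_tlift => a b; rewrite !mulrA.
Qed.

(** Uniqueness of convolution inverses. Let [F], [R], [L] send [(g, h)] to [g h],
    [S (g h)], [S h * S g]. Then [R * F = L * F] is the source counital map of
    the product, so [R = R * F * R = L * F * R]; as [F * R] is the target
    counital map of the product, the absorption lemmas for
    [S a * εt (b * x)] turn [L * F * R] into [L]. *)
Lemma antipodeM g h : S (g * h) = S h * S g.
Proof.
rewrite -sw_source_antipode comulM sw_mul; last by multilin.
(* [R * F * R = L * F * R] *)
transitivity (\sw_(a, b <- Δ g) \sw_(c, d <- Δ h)
    \sw_(a1, a2 <- Δ a) \sw_(c1, c2 <- Δ c) S c1 * S a1 * (a2 * c2) * S (b * d)).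
  apply: eq_tlift => a b; apply: eq_tlift => c d.
  rewrite -sw_antipode_mul_l sw_mull; apply: eq_tlift => a1 a2.
  by rewrite sw_mull.
(* coassociativity in [g] and in [h] rebrackets this as [L * (F * R)] *)
transitivity (\sw_(a, b <- Δ g) \sw_(c, d <- Δ h)
    \sw_(b1, b2 <- Δ b) \sw_(d1, d2 <- Δ d) S c * S a * (b1 * d1 * S (b2 * d2))).
  transitivity (\sw_(a, b <- Δ g) \sw_(a1, a2 <- Δ a) \sw_(c, d <- Δ h)
      \sw_(c1, c2 <- Δ c) S c1 * S a1 * (a2 * c2) * S (b * d)).
    by apply: eq_tlift => a b; rewrite sw_exchange.
  rewrite (sw_coassoc A (f := fun a1 a2 b => \sw_(c, d <- Δ h)
      \sw_(c1, c2 <- Δ c) S c1 * S a1 * (a2 * c2) * S (b * d))); last by multilin.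
  apply: eq_tlift => a b; rewrite [RHS]sw_exchange; apply: eq_tlift => b1 b2.
  rewrite (sw_coassoc A (f := fun c1 c2 d => S c1 * S a * (b1 * c2) * S (b2 * d)));
    last by multilin.
  by apply: eq_tlift => c d; apply: eq_tlift => d1 d2; rewrite !mulrA.
transitivity (\sw_(a, b <- Δ g) \sw_(c, d <- Δ h) S c * S a * εt (b * d)).
  apply: eq_tlift => a b; apply: eq_tlift => c d.
  rewrite -antipode_rE comulM sw_mul; last by multilin.
  rewrite sw_mulr; apply: eq_tlift => b1 b2; rewrite sw_mulr.
  by apply: eq_tlift => d1 d2; rewrite mulrA.
rewrite sw_exchange -sw_antipode_target sw_mull; apply: eq_tlift => c d.
rewrite -!mulrA -sw_antipode_target_mul sw_mulr.
by apply: eq_tlift => a b; rewrite mulrA.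
Qed.

End WeakHopf.

(** * Multiplicativity of the maps into the third tensor power *)

Section CubeAlgebra.
Variables (k : fieldType) (H : pzAlgType k).
Local Notation "\sw_ ( a , b <- t ) E" := (tlift (fun a b : H => E) t).

(** Multiplicativity of a linear map on a tensor product of algebras has to be
    tested on pure tensors only. *)
Lemma lin_tens_mul (R : pzAlgType k) (F : H ⊗ H -> R) : lin F ->
  (forall a b c d : H, F ((a * c) ⊗ (b * d)) = F (a ⊗ b) * F (c ⊗ d)) ->
  forall s t : (H ⊗ H)%type, F (s * t) = F s * F t.
Proof.
move=> lF FM s t; rewrite -{1}[s]sw_id -{2}[s]sw_id sw_mull !lin_sw// sw_mull.
apply: eq_tlift => a b.
rewrite -{1}[t]sw_id -{2}[t]sw_id.
rewrite (lin_sw (g := fun z => F ((a ⊗ b) * z))); last by multilin.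
rewrite lin_sw// sw_mulr.
by apply: eq_tlift => c d; rewrite mul_tens FM.
Qed.

Lemma tassoc_mul (a c : H) (x y : (H ⊗ H)%type) :
  tassoc ((a * c) ⊗ (x * y)) = tassoc (a ⊗ x) * tassoc (c ⊗ y)
  :> ((H ⊗ H) ⊗ H)%type.
Proof.
rewrite -{1}[x]sw_id -{2}[x]sw_id.
rewrite sw_mull (lin_sw (g := fun z => tassoc ((a * c) ⊗ z))); last by multilin.
rewrite (lin_sw (g := fun z => tassoc (a ⊗ z))); last by multilin.
rewrite sw_mull; apply: eq_tlift => b1 b2.
rewrite -{1}[y]sw_id -{2}[y]sw_id.
rewrite sw_mulr (lin_sw (g := fun z => tassoc ((a * c) ⊗ z))); last by multilin.
rewrite (lin_sw (g := fun z => tassoc (c ⊗ z))); last by multilin.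
rewrite sw_mulr; apply: eq_tlift => d1 d2.
by rewrite mul_tens !tassoc_tens !mul_tens.
Qed.

Variable D : {linear H -> (H ⊗ H)%type}.
Hypothesis DM : forall a b, D (a * b) = D a * D b.

Lemma tmap_comull_mul (s t : (H ⊗ H)%type) :
  tmap D idfun (s * t) = tmap D idfun s * tmap D idfun t :> ((H ⊗ H) ⊗ H)%type.
Proof.
apply: lin_tens_mul => [|a b c d]; first by multilin.
by rewrite !tmap_tens /= DM mul_tens.
Qed.

Lemma tmap_comulr_mul (s t : (H ⊗ H)%type) :
  tassoc (tmap idfun D (s * t)) =
  tassoc (tmap idfun D s) * tassoc (tmap idfun D t) :> ((H ⊗ H) ⊗ H)%type.
Proof.
apply: (lin_tens_mul (F := fun t => tassoc (tmap idfun D t))) => [|a b c d]; first by multilin.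
by rewrite !tmap_tens /= DM tassoc_mul.
Qed.

End CubeAlgebra.

(** * Normalisation of a twist *)

Section Twist.
Variables (k : fieldType) (H : pzAlgType k) (A : weak_hopf_algebra H).
Variables (T Tb : (H ⊗ H)%type).
Hypothesis hT : is_twist A T Tb.
Implicit Types (U : lmodType k) (g h u x y z w : H).
Local Notation "\sw_ ( a , b <- t ) E" := (tlift (fun a b : H => E) t).
Local Notation Δ := (comul A).
Local Notation ε := (counit A).
Local Notation S := (antipode A).
Local Notation εt := (target_map A).
Local Notation εs := (source_map A).
Local Notation εt' := (target_map' A).
Local Notation εs' := (source_map' A).

Let lt : lin εt. Proof. exact: lin_target_map. Qed.
Let ls : lin εs. Proof. exact: lin_source_map. Qed.
Let lt' : lin εt'. Proof. exact: lin_target_map'. Qed.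
Let ls' : lin εs'. Proof. exact: lin_source_map'. Qed.

Lemma comul1_twist : Δ 1 * T = T.
Proof. by case: (twist_range hT) => x ->; rewrite mulrA comul1_mul. Qed.
Lemma twist_bar_comul1 : Tb * Δ 1 = Tb.
Proof. by case: (twist_bar_range hT) => x ->; rewrite -mulrA mul_comul1. Qed.

(** The four counit conditions on a twist are used in this form. For instance
    [ε(T_1) T_2 = 1] with [T = Δ 1 * T] reads [ε(1_1 T_1) 1_2 T_2 = 1]. *)
Lemma twist_target_map : \sw_(a, b <- T) εt a * b = 1.
Proof.
rewrite -(twist_counitl hT) -[in RHS]comul1_twist /contractl sw_mul; last by multilin.
rewrite sw_exchange; apply: eq_tlift => a b.
by rewrite sw_mull; apply: eq_tlift => c d; rewrite pzscalerAl.
Qed.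

Lemma twist_source_map' : \sw_(a, b <- T) εs' b * a = 1.
Proof.
rewrite -(twist_counitr hT) -[in RHS]comul1_twist /contractr sw_mul; last by multilin.
rewrite sw_exchange; apply: eq_tlift => a b.
by rewrite sw_mull; apply: eq_tlift => c d; rewrite pzscalerAl.
Qed.

Lemma twist_bar_target_map' : \sw_(a, b <- Tb) b * εt' a = 1.
Proof.
rewrite -(twist_bar_counitl hT) -[in RHS]twist_bar_comul1 /contractl sw_mul; last by multilin.
apply: eq_tlift => a b.
by rewrite sw_mulr; apply: eq_tlift => c d; rewrite pzscalerAr.
Qed.

Lemma twist_bar_source_map : \sw_(a, b <- Tb) a * εs b = 1.
Proof.
rewrite -(twist_bar_counitr hT) -[in RHS]twist_bar_comul1 /contractr sw_mul; last by multilin.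
apply: eq_tlift => a b.
by rewrite sw_mulr; apply: eq_tlift => c d; rewrite pzscalerAr.
Qed.

(** * The twisted weak bialgebra *)

Definition twisted_comul h : (H ⊗ H)%type := Tb * Δ h * T.

Fact twisted_comul_linear : linear twisted_comul.
Proof.
have lD : lin twisted_comul by rewrite /twisted_comul; multilin.
exact: lD.
Qed.
HB.instance Definition _ :=
  GRing.isLinear.Build k H (tensor H H) *:%R twisted_comul twisted_comul_linear.

Local Notation ΔT := twisted_comul.

Lemma sw_twisted_comul U (f : H -> H -> U) h : bilin f ->
  tlift f (ΔT h) = \sw_(p, q <- Tb) \sw_(c, d <- T) \sw_(a, b <- Δ h)
    f (p * a * c) (q * b * d).
Proof.
move=> bf; rewrite /twisted_comul sw_mul// sw_mul; last by multilin.
by apply: eq_tlift => p q; rewrite sw_exchange.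
Qed.

(** The twisted comultiplication carries a copy of [Tb] on its left and of [T] on
    its right. Applying the counit on the first leg turns the two copies into
    counital images, which the normalisation of the twist then collapses to
    [1]. *)
Lemma sw_twisted_counitl U (f : H -> U) h g u : lin f ->
  \sw_(x, y <- ΔT g) ε (h * x * u) *: f y =
  \sw_(p, q <- Tb) \sw_(c, d <- T) f (q * εt' (h * p) * g * (εt (c * u) * d)).
Proof.
move=> lf; rewrite sw_twisted_comul; last by multilin.
apply: eq_tlift => p q; apply: eq_tlift => c d.
transitivity (f (q * (εt' (h * p) * g * εt (c * u)) * d)); last by rewrite !mulrA.
rewrite -(sw_counit_mull A (f := fun y => f (q * y * d))); last by multilin.
by apply: eq_tlift => a b; rewrite !mulrA.
Qed.

Lemma sw_twisted_counitr U (f : H -> U) h g u : lin f ->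
  \sw_(x, y <- ΔT g) ε (h * y * u) *: f x =
  \sw_(p, q <- Tb) \sw_(c, d <- T) f (p * εs (h * q) * g * (εs' (d * u) * c)).
Proof.
move=> lf; rewrite sw_twisted_comul; last by multilin.
apply: eq_tlift => p q; apply: eq_tlift => c d.
transitivity (f (p * (εs (h * q) * g * εs' (d * u)) * c)); last by rewrite !mulrA.
rewrite -(sw_counit_mulr A (f := fun y => f (p * y * c))); last by multilin.
by apply: eq_tlift => a b; rewrite !mulrA.
Qed.

Lemma sw_twisted_counitl1 U (f : H -> U) h g : lin f ->
  \sw_(x, y <- ΔT g) ε (h * x) *: f y =
  \sw_(p, q <- Tb) f (q * εt' (h * p) * g).
Proof.
move=> lf; transitivity (\sw_(x, y <- ΔT g) ε (h * x * 1) *: f y).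
  by apply: eq_tlift => x y; rewrite mulr1.
rewrite sw_twisted_counitl//; apply: eq_tlift => p q.
rewrite -(lin_sw (g := fun z => f (q * εt' (h * p) * g * z))); last by multilin.
congr (f _); rewrite -[RHS]mulr1 -[in RHS]twist_target_map; congr (_ * _).
by apply: eq_tlift => c d; rewrite mulr1.
Qed.

Lemma sw_twisted_counitr1 U (f : H -> U) h g : lin f ->
  \sw_(x, y <- ΔT g) ε (h * y) *: f x =
  \sw_(p, q <- Tb) f (p * εs (h * q) * g).
Proof.
move=> lf; transitivity (\sw_(x, y <- ΔT g) ε (h * y * 1) *: f x).
  by apply: eq_tlift => x y; rewrite mulr1.
rewrite sw_twisted_counitr//; apply: eq_tlift => p q.
rewrite -(lin_sw (g := fun z => f (p * εs (h * q) * g * z))); last by multilin.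
congr (f _); rewrite -[RHS]mulr1 -[in RHS]twist_source_map'; congr (_ * _).
by apply: eq_tlift => c d; rewrite mulr1.
Qed.

Lemma twisted_counit_comull h : contractl ε (ΔT h) = h.
Proof.
transitivity (\sw_(a, b <- ΔT h) ε (1 * a) *: b).
  by apply: eq_tlift => a b; rewrite mul1r.
rewrite (sw_twisted_counitl1 (f := fun b => b)); last by multilin.
rewrite -[RHS]mul1r -[in RHS]twist_bar_target_map' sw_mull.
by apply: eq_tlift => p q; rewrite mul1r.
Qed.

Lemma twisted_counit_comulr h : contractr ε (ΔT h) = h.
Proof.
transitivity (\sw_(a, b <- ΔT h) ε (1 * b) *: a).
  by apply: eq_tlift => a b; rewrite mul1r.
rewrite (sw_twisted_counitr1 (f := fun b => b)); last by multilin.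
rewrite -[RHS]mul1r -[in RHS]twist_bar_source_map sw_mull.
by apply: eq_tlift => p q; rewrite mul1r.
Qed.

Lemma twisted_comulM h g : ΔT (h * g) = ΔT h * ΔT g.
Proof.
rewrite /twisted_comul -!mulrA [T * _]mulrA (twist_mul_bar hT).
by rewrite [Δ 1 * _]mulrA comul1_mul [Δ h * (_ * _)]mulrA -comulM.
Qed.

(** Both sides become [Tb]-sums of [ε(q εt'(h p) g f)] and [ε(h p εs(q) g f)],
    equal term by term; the second one collapses since [p εs(q)] sums to [1]. *)
Lemma twisted_counitM12 h g f :
  ε (h * g * f) = \sw_(g1, g2 <- ΔT g) ε (h * g1) * ε (g2 * f).
Proof.
transitivity (\sw_(g1, g2 <- ΔT g) (ε (h * g1) *: (ε (g2 * f) : k^o)) : k^o); last by [].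
rewrite (sw_twisted_counitl1 (U := k^o) (f := fun y => ε (y * f))); last by multilin.
transitivity (\sw_(p, q <- Tb) ε (h * (p * εs q * (g * f)))).
  rewrite -(lin_sw (g := (fun y => ε (h * (y * (g * f)))) : H -> k^o)); last by multilin.
  by rewrite twist_bar_source_map mul1r mulrA.
apply: eq_tlift => p q; rewrite -[in RHS]mulrA -[in RHS]mulrA counit_target'_source.
by rewrite !mulrA.
Qed.

Lemma twisted_counitM21 h g f :
  ε (h * g * f) = \sw_(g1, g2 <- ΔT g) ε (h * g2) * ε (g1 * f).
Proof.
transitivity (\sw_(g1, g2 <- ΔT g) (ε (h * g2) *: (ε (g1 * f) : k^o)) : k^o); last by [].
rewrite (sw_twisted_counitr1 (U := k^o) (f := fun y => ε (y * f))); last by multilin.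
transitivity (\sw_(p, q <- Tb) ε (h * (q * εt' p * (g * f)))).
  rewrite -(lin_sw (g := (fun y => ε (h * (y * (g * f)))) : H -> k^o)); last by multilin.
  by rewrite twist_bar_target_map' mul1r mulrA.
apply: eq_tlift => p q; rewrite -[in RHS]mulrA -[in RHS]mulrA -counit_target'_source.
by rewrite !mulrA.
Qed.

Lemma mul_tensl1 (s t : (H ⊗ H)%type) :
  (s * t) ⊗ (1 : H) = (s ⊗ (1 : H)) * (t ⊗ (1 : H)).
Proof. by rewrite mul_tens mulr1. Qed.

Lemma mul_tensr1 (s t : (H ⊗ H)%type) :
  tassoc ((1 : H) ⊗ (s * t)) = tassoc ((1 : H) ⊗ s) * tassoc ((1 : H) ⊗ t).
Proof. by rewrite -tassoc_mul mulr1. Qed.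

Lemma tmap_twisted_l (t : (H ⊗ H)%type) :
  tmap ΔT idfun t = (Tb ⊗ (1 : H)) * tmap Δ idfun t * (T ⊗ (1 : H)).
Proof.
apply: (lin_tens_ext (F := tmap ΔT idfun)
  (G := fun t => (Tb ⊗ (1 : H)) * tmap Δ idfun t * (T ⊗ (1 : H)))) => [| |a b];
  try by multilin.
by rewrite !tmap_tens !mul_tens mul1r mulr1.
Qed.

Lemma tmap_twisted_r (t : (H ⊗ H)%type) :
  tassoc (tmap idfun ΔT t) =
  tassoc ((1 : H) ⊗ Tb) * tassoc (tmap idfun Δ t) * tassoc ((1 : H) ⊗ T).
Proof.
apply: (lin_tens_ext (F := fun t => tassoc (tmap idfun ΔT t))
  (G := fun t => tassoc ((1 : H) ⊗ Tb) * tassoc (tmap idfun Δ t) *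
    tassoc ((1 : H) ⊗ T))) => [| |a b]; try by multilin.
by rewrite !tmap_tens -!tassoc_mul /= mul1r mulr1.
Qed.

Let Δl_mul := tmap_comull_mul (comulM A).
Let Δr_mul := tmap_comulr_mul (comulM A).

Lemma twisted_comulA h :
  tmap ΔT idfun (ΔT h) = tassoc (tmap idfun ΔT (ΔT h)).
Proof.
rewrite tmap_twisted_l tmap_twisted_r.
rewrite {1}/twisted_comul /twisted_comul !Δl_mul !Δr_mul !mulrA.
rewrite (twist_bar_cocycle hT) -!mulrA (twist_cocycle hT).
by rewrite comulA.
Qed.

Lemma twisted_comul1 : ΔT 1 = Tb * T.
Proof. by rewrite /twisted_comul twist_bar_comul1. Qed.

(** The mixed identity between [T] and [Tb] rewrites the middle [T ⊗ 1] times
    [1 ⊗ Tb] as a product of comultiplications, and the cocycle identity moves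
    the remaining [1 ⊗ T]. *)
Lemma twisted_comul1_lr :
  tmap ΔT idfun (ΔT 1) = (ΔT 1 ⊗ (1 : H)) * tassoc ((1 : H) ⊗ ΔT 1).
Proof.
rewrite tmap_twisted_l twisted_comul1 Δl_mul mul_tensl1 mul_tensr1.
rewrite [RHS](_ : _ = (Tb ⊗ (1 : H)) * ((T ⊗ (1 : H)) * tassoc ((1 : H) ⊗ Tb))
  * tassoc ((1 : H) ⊗ T)); last by rewrite !mulrA.
by rewrite -(twist_mixed_lr hT) -!mulrA -(twist_cocycle hT).
Qed.

Lemma twisted_comul1_rl :
  tmap ΔT idfun (ΔT 1) = tassoc ((1 : H) ⊗ ΔT 1) * (ΔT 1 ⊗ (1 : H)).
Proof.
rewrite tmap_twisted_l twisted_comul1 Δl_mul mul_tensl1 mul_tensr1.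
rewrite [RHS](_ : _ = tassoc ((1 : H) ⊗ Tb) * (tassoc ((1 : H) ⊗ T) *
  (Tb ⊗ (1 : H))) * (T ⊗ (1 : H))); last by rewrite !mulrA.
by rewrite -(twist_mixed_rl hT) !mulrA (twist_bar_cocycle hT).
Qed.

Definition twisted_bialgebra : weak_bialgebra H :=
  WeakBialgebra twisted_comulA twisted_counit_comull twisted_counit_comulr
    twisted_comulM twisted_counitM12 twisted_counitM21
    twisted_comul1_lr twisted_comul1_rl.

(** * The twisted antipode *)

(** The element called [v] in the theorem, and its inverse below, which is the
    same expression formed from [Tb] with [S] on the other leg. *)
Definition twist_elt := \sw_(a, b <- T) S a * b.
Definition twist_elt_inv := \sw_(p, q <- Tb) p * S q.
Local Notation v := twist_elt.
Local Notation vi := twist_elt_inv.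

(** The mixed twist identities evaluated on a trilinear expression. They are
    the only link between [T] and [Tb] across different legs and are what makes
    [twist_elt] invertible. *)
Lemma sw_mixed_lr U (f : H -> H -> H -> U) : trilin f ->
  \sw_(a, b <- T) \sw_(p, q <- Tb) f a (b * p) q =
  \sw_(p, q <- Tb) \sw_(p1, p2 <- Δ p) \sw_(a, b <- T) \sw_(b1, b2 <- Δ b)
    f (p1 * a) (p2 * b1) (q * b2).
Proof.
move=> tf; rewrite -tlift3_mul_lr// -(twist_mixed_lr hT) tlift3_mul//.
rewrite tlift3_comull; last by rewrite /tlift3; multilin.
apply: eq_tlift => p q; apply: eq_tlift => p1 p2.
by rewrite tlift3_comulr//; multilin.
Qed.

Lemma sw_mixed_rl U (f : H -> H -> H -> U) : trilin f ->
  \sw_(c, d <- T) \sw_(p, q <- Tb) f p (c * q) d =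
  \sw_(p, q <- Tb) \sw_(q1, q2 <- Δ q) \sw_(a, b <- T) \sw_(a1, a2 <- Δ a)
    f (p * a1) (q1 * a2) (q2 * b).
Proof.
move=> tf; rewrite -tlift3_mul_rl// -(twist_mixed_rl hT) tlift3_mul//.
rewrite tlift3_comulr; last by rewrite /tlift3; multilin.
apply: eq_tlift => p q; apply: eq_tlift => q1 q2.
by rewrite tlift3_comull//; multilin.
Qed.

(** The image under [S] of the normalisation [εs'(T_2) T_1 = 1], because
    [S (εs' x) = εt x] and [S] reverses products. *)
Lemma twist_antipode_target : \sw_(a, b <- T) S a * εt b = 1.
Proof.
rewrite -(antipode1 A) -[in RHS]twist_source_map' lin_sw; last by multilin.
by apply: eq_tlift => a b; rewrite antipodeM antipode_source_map'.
Qed.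

Lemma twist_bar_source_antipode : \sw_(p, q <- Tb) εs p * S q = 1.
Proof.
rewrite -(antipode1 A) -[in RHS]twist_bar_target_map' lin_sw; last by multilin.
by apply: eq_tlift => p q; rewrite antipodeM antipode_target_map'.
Qed.

(** The product is [S(T_1) (T_2 Tb_1) S(Tb_2)]; by the mixed identity it is
    [S(T_1) S(p_1) p_2 b_1 S(b_2) S(Tb_2)] where [p = Tb_1] and [b = T_2], and the
    two antipode axioms turn the middle into commuting counital images. *)
Lemma twist_elt_mulV : v * vi = 1.
Proof.
transitivity (\sw_(a, b <- T) \sw_(p, q <- Tb) S a * (b * p) * S q).
  rewrite /twist_elt sw_mull; apply: eq_tlift => a b.
  by rewrite /twist_elt_inv sw_mulr; apply: eq_tlift => p q; rewrite !mulrA.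
rewrite (sw_mixed_lr (f := fun a b c => S a * b * S c)); last by multilin.
transitivity (\sw_(p, q <- Tb) \sw_(a, b <- T) S a * εs p * (εt b * S q)).
  apply: eq_tlift => p q; rewrite sw_exchange; apply: eq_tlift => a b.
  rewrite -antipode_lE sw_mulr sw_mull; apply: eq_tlift => p1 p2.
  rewrite -antipode_rE sw_mull sw_mulr; apply: eq_tlift => b1 b2.
  by rewrite !antipodeM !mulrA.
transitivity ((\sw_(a, b <- T) S a * εt b) * (\sw_(p, q <- Tb) εs p * S q)).
  rewrite sw_exchange sw_mull; apply: eq_tlift => a b.
  rewrite sw_mulr; apply: eq_tlift => p q.
  by rewrite !mulrA -[X in X * S q = _]mulrA -target_source_map_comm !mulrA.
by rewrite twist_antipode_target twist_bar_source_antipode mulr1.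
Qed.

(** The computation [vinv * v = 1] with a target element [z] and a source element
    [w] inserted. The case [z = w = 1] is that identity, and the cases
    [z = εt h], [w = 1] and [z = 1], [w = εs h] are the two antipode axioms of
    the twisted structure. *)
Lemma twist_sandwich z w : in_target A z -> in_source A w ->
  (\sw_(p, q <- Tb) p * z * S q) * (\sw_(a, b <- T) S a * w * b) =
  (\sw_(p, q <- Tb) p * εs (w * q)) * (\sw_(a, b <- T) εt (a * z) * b).
Proof.
move=> tz sw.
transitivity (\sw_(c, d <- T) \sw_(p, q <- Tb) p * z * S (c * q) * w * d).
  rewrite sw_exchange sw_mull; apply: eq_tlift => p q.
  by rewrite sw_mulr; apply: eq_tlift => a b; rewrite antipodeM !mulrA.
rewrite (sw_mixed_rl (f := fun a b c => a * z * S b * w * c)); last by multilin.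
rewrite [RHS]sw_mull; apply: eq_tlift => p q; rewrite [RHS]sw_mulr sw_exchange.
apply: eq_tlift => a b.
transitivity (p * (εt (a * z) * εs (w * q)) * b); last first.
  by rewrite target_source_map_comm !mulrA.
rewrite -sw_antipode_l// sw_mulr sw_mulr sw_mull; apply: eq_tlift => q1 q2.
rewrite -sw_antipode_r// sw_mull sw_mulr sw_mull; apply: eq_tlift => a1 a2.
by rewrite antipodeM !mulrA.
Qed.

Lemma twist_elt_Vmul : vi * v = 1.
Proof.
have t1 := in_target1 A.
have s1 := in_source1 A.
transitivity ((\sw_(p, q <- Tb) p * 1 * S q) * (\sw_(a, b <- T) S a * 1 * b)).
  by congr (_ * _); apply: eq_tlift => a b; rewrite mulr1.
rewrite twist_sandwich// -[RHS]mulr1 -[X in _ = X * _]twist_bar_source_map.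
rewrite -[X in _ = _ * X]twist_target_map.
by congr (_ * _); apply: eq_tlift => a b; rewrite ?mul1r ?mulr1.
Qed.

Definition twisted_antipode h := vi * S h * v.
Local Notation ST := twisted_antipode.

Fact twisted_antipode_linear : linear ST.
Proof.
have lD : lin ST by rewrite /twisted_antipode; multilin.
exact: lD.
Qed.
HB.instance Definition _ :=
  GRing.isLinear.Build k H H *:%R ST twisted_antipode_linear.

Lemma twisted_antipodeM g h : ST (g * h) = ST h * ST g.
Proof.
rewrite /twisted_antipode antipodeM -!mulrA [v * _]mulrA twist_elt_mulV mul1r.
by rewrite !mulrA.
Qed.

(** Since [S] reverses products, this is [x_1 S(x_2)] for [x = T * Tb = Δ 1]. *)
Lemma twist_mul_antipode : \sw_(c, d <- T) c * vi * S d = 1.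
Proof.
rewrite -[RHS](target_map1 A) -antipode_rE -(twist_mul_bar hT) sw_mul; last by multilin.
apply: eq_tlift => c d; rewrite sw_mulr sw_mull; apply: eq_tlift => p q.
by rewrite antipodeM !mulrA.
Qed.

Lemma twist_antipode_mul : \sw_(p, q <- Tb) S p * v * q = 1.
Proof.
rewrite -[RHS](source_map1 A) -antipode_lE -(twist_mul_bar hT) sw_mul; last by multilin.
rewrite sw_exchange; apply: eq_tlift => p q.
rewrite sw_mulr sw_mull; apply: eq_tlift => c d.
by rewrite antipodeM !mulrA.
Qed.

(** The factors [T_1], [vinv], [S(T_2)] collapse to [1], so [h_1 ST(h_2)] is
    [Tb_1 εt(h) S(Tb_2) v], a case of [twist_sandwich]. Both sides are then
    equal to [εt(T_1 h) T_2]. *)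
Lemma twisted_antipode_r h :
  \sw_(h1, h2 <- ΔT h) h1 * ST h2 = contractl ε (ΔT 1 * (h ⊗ (1 : H))).
Proof.
transitivity (\sw_(a, b <- T) εt (a * h) * b).
  have s1 := in_source1 A.
  rewrite sw_twisted_comul; last by rewrite /twisted_antipode; multilin.
  transitivity ((\sw_(p, q <- Tb) p * εt h * S q) * v).
    rewrite sw_mull; apply: eq_tlift => p q.
    transitivity (\sw_(a, b <- Δ h) p * (a * S b) * S q * v).
      rewrite sw_exchange; apply: eq_tlift => a b.
      transitivity (p * a * (\sw_(c, d <- T) c * vi * S d) * (S b * S q * v));
        last by rewrite twist_mul_antipode mulr1 !mulrA.
      rewrite (sw_mulr _ T) (sw_mull _ T); apply: eq_tlift => c d.
      by rewrite /twisted_antipode !antipodeM !mulrA.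
    by rewrite -antipode_rE (sw_mulr _ (Δ h)) !(sw_mull _ (Δ h)).
  transitivity ((\sw_(p, q <- Tb) p * εt h * S q) * (\sw_(a, b <- T) S a * 1 * b)).
    by congr (_ * _); apply: eq_tlift => a b; rewrite mulr1.
  rewrite twist_sandwich//; last exact: in_target_map.
  rewrite -[RHS]mul1r -[X in _ = X * _]twist_bar_source_map; congr (_ * _).
    by apply: eq_tlift => a b; rewrite mul1r.
  by apply: eq_tlift => a b; rewrite target_map_mul.
rewrite /contractl sw_mul_tensr; last by multilin.
transitivity (\sw_(a, b <- ΔT 1) ε (1 * a * h) *: b); last first.
  by apply: eq_tlift => a b; rewrite mul1r mulr1.
rewrite (sw_twisted_counitl (f := fun y => y)); last by multilin.
rewrite -[LHS]mul1r -[X in X * _ = _]twist_bar_target_map' sw_mull.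
apply: eq_tlift => p q; rewrite sw_mulr; apply: eq_tlift => c d.
by rewrite mul1r mulr1.
Qed.

(** Mirror image: both sides are equal to [Tb_1 εs(h Tb_2)]. *)
Lemma twisted_antipode_l h :
  \sw_(h1, h2 <- ΔT h) ST h1 * h2 = contractr ε (((1 : H) ⊗ h) * ΔT 1).
Proof.
transitivity (\sw_(p, q <- Tb) p * εs (h * q)).
  have t1 := in_target1 A.
  rewrite sw_twisted_comul; last by rewrite /twisted_antipode; multilin.
  transitivity (vi * (\sw_(c, d <- T) S c * εs h * d)).
    rewrite (sw_mulr _ T) sw_exchange; apply: eq_tlift => c d.
    transitivity (\sw_(a, b <- Δ h) vi * (S c * (S a * b) * d)).
      rewrite sw_exchange; apply: eq_tlift => a b.
      transitivity (vi * S c * S a * (\sw_(p, q <- Tb) S p * v * q) * (b * d));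
        last by rewrite twist_antipode_mul mulr1 !mulrA.
      rewrite (sw_mulr _ Tb) (sw_mull _ Tb); apply: eq_tlift => p q.
      by rewrite /twisted_antipode !antipodeM !mulrA.
    by rewrite -antipode_lE (sw_mulr _ (Δ h)) (sw_mull _ (Δ h)) (sw_mulr _ (Δ h)).
  transitivity ((\sw_(p, q <- Tb) p * 1 * S q) * (\sw_(c, d <- T) S c * εs h * d)).
    by congr (_ * _); apply: eq_tlift => a b; rewrite mulr1.
  rewrite twist_sandwich//; last exact: in_source_map.
  rewrite -[RHS]mulr1 -[X in _ = _ * X]twist_target_map; congr (_ * _).
    by apply: eq_tlift => a b; rewrite source_map_mul.
  by apply: eq_tlift => a b; rewrite mulr1.
rewrite /contractr sw_tensl_mul; last by multilin.
transitivity (\sw_(a, b <- ΔT 1) ε (h * b * 1) *: a); last first.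
  by apply: eq_tlift => a b; rewrite mul1r mulr1.
rewrite (sw_twisted_counitr (f := fun y => y)); last by multilin.
rewrite -[LHS]mulr1 -[X in _ * X = _]twist_source_map' sw_mull.
apply: eq_tlift => p q; rewrite sw_mulr; apply: eq_tlift => c d.
by rewrite !mulr1.
Qed.

(** In any weak bialgebra with a product-reversing [S] satisfying the first two
    antipode axioms, [S(h_1) εt(h_2) = S(1_1 h) 1_2 = S(h) S(1_1) 1_2 = S(h)];
    this is applied to the twisted bialgebra. *)
Lemma twisted_antipode_lr h :
  tlift (fun (h12 : (H ⊗ H)%type) h3 =>
    \sw_(h1, h2 <- h12) ST h1 * h2 * ST h3) (tmap ΔT idfun (ΔT h)) = ST h.
Proof.
have lST : lin ST by rewrite /twisted_antipode; multilin.
have lΔT : lin ΔT by rewrite /twisted_comul; multilin.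
rewrite -/(tlift3 (fun h1 h2 h3 => ST h1 * h2 * ST h3) _) twisted_comulA.
rewrite tlift3_comulr; last by multilin.
transitivity (\sw_(a, b <- ΔT h) ST a * target_map twisted_bialgebra b).
  apply: eq_tlift => a b; rewrite -target_mapE -twisted_antipode_r sw_mulr.
  by apply: eq_tlift => b1 b2; rewrite mulrA.
rewrite (sw_target_map twisted_bialgebra (f := fun a b => ST a * b)); last by multilin.
transitivity (ST h * source_map twisted_bialgebra 1); last by rewrite source_map1 mulr1.
rewrite -source_mapE -twisted_antipode_l (sw_mulr _ (ΔT 1)).
by apply: eq_tlift => a b; rewrite twisted_antipodeM [RHS]mulrA.
Qed.

Definition twisted_hopf : weak_hopf_algebra H :=
  @WeakHopfAlgebra k H twisted_bialgebra ST twisted_antipode_r twisted_antipode_l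
    twisted_antipode_lr.

End Twist.

Theorem proposition3p1p2 (k : closedFieldType) (H : pzAlgType k)
    (A : weak_hopf_algebra H) (T Tb : (H ⊗ H)%type) (hT : is_twist A T Tb) :
  let v := tlift (fun a b : H => antipode A a * b) T in
  exists vinv : H, [/\ v * vinv = 1, vinv * v = 1 &
    exists HT : weak_hopf_algebra H,
      [/\ forall h, counit HT h = counit A h,
          forall h, comul HT h = Tb * comul A h * T &
          forall h, antipode HT h = vinv * antipode A h * v]].
Proof.
exists (twist_elt_inv A Tb); split.
- exact: twist_elt_mulV hT.
- exact: twist_elt_Vmul hT.
by exists (twisted_hopf hT).
Qed.
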